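(* Let $(\Omega_n,P_n,\pi_n)$ be a sequence of lazy reversible irreducible finite Markov chains. The following are equivalent: 1) The sequence exhibits a cutoff. 2) The sequence exhibits a $\mathrm{hit}_\alpha$-cutoff for some $\alpha\in(0,1/2]$. 3) The sequence exhibits a $\mathrm{hit}_\alpha$-cutoff for some $\alpha\in(1/2,1)$, and $t_{\mathrm{rel}}^{(n)}=o(t_{\mathrm{mix}}^{(n)})$.
   Context: A finite chain $(\Omega,P,\pi)$ has state space $\Omega$, transition matrix $P$, stationary distribution $\pi$; it is lazy if $P(x,x)\ge1/2$ for all $x$ and reversible if $\pi(x)P(x,y)=\pi(y)P(y,x)$. Time is discrete. Chains have at least two states. The eigenvalues of $P$ are $1=\lambda_1>\lambda_2\ge\dots\ge\lambda_{|\Omega|}\ge 0$ and $t_{\mathrm{rel}}:=(1-\lambda_2)^{-1}$. Let $d(t):=\max_{x}\|P^t(x,\cdot)-\pi\|_{\mathrm{TV}}$, $t_{\mathrm{mix}}(\epsilon):=\inf\{t\ge 0: d(t)\le\epsilon\}$, $t_{\mathrm{mix}}:=t_{\mathrm{mix}}(1/4)$. A superscript $(n)$ denotes the quantity for the $n$-th chain. For $A\subset\Omega$ let $T_A:=\inf\{t\ge 0:X_t\in A\}$, and let $\mathrm P_x$ be the law of the chain started at $x$. For $\alpha,\epsilon\in(0,1)$ let $p(\alpha,t):=\max_{x\in\Omega}\max_{A\subset\Omega:\,\pi(A)\ge\alpha}\mathrm P_x[T_A>t]$ and $\mathrm{hit}_\alpha(\epsilon):=\min\{t:p(\alpha,t)\le\epsilon\}$.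 A sequence exhibits a cutoff if $\lim_{n\to\infty}t_{\mathrm{mix}}^{(n)}(\epsilon)/t_{\mathrm{mix}}^{(n)}(1-\epsilon)=1$ for every $0<\epsilon<1$. It exhibits a $\mathrm{hit}_\alpha$-cutoff if for every $\epsilon\in(0,1/4)$, $\mathrm{hit}_\alpha^{(n)}(\epsilon)-\mathrm{hit}_\alpha^{(n)}(1-\epsilon)=o(\mathrm{hit}_\alpha^{(n)}(1/4))$ as $n\to\infty$. *)

(* Defs.v *)
From mathcomp Require Import all_boot all_order all_algebra.
From mathcomp Require Import boolp classical_sets reals topology normedtype.
From mathcomp Require Import landau sequences.

Set Implicit Arguments.
Unset Strict Implicit.
Unset Printing Implicit Defensive.

Import Order.TTheory GRing.Theory Num.Theory.
Import numFieldNormedType.Exports.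

Local Open Scope ring_scope.
Local Open Scope classical_set_scope.

Record finite_chain (R : realType) := FiniteChain {
  state : finType;
  trans : state -> state -> R;
  stat : state -> R;
  card_state_gt1 : (1 < #|state|)%N;
  trans_ge0 : forall x y, 0 <= trans x y;
  trans_sum1 : forall x, \sum_y trans x y = 1;
  stat_ge0 : forall x, 0 <= stat x;
  stat_sum1 : \sum_x stat x = 1;
  stat_invariant : forall y, \sum_x stat x * trans x y = stat y }.

(* Least t satisfying Q; the value 0 is also used when there is none. *)
Definition min_time (Q : pred nat) : nat :=
  if pselect (exists t, Q t) is left exQ then ex_minn exQ else 0%N.

(* The eigenvalues of M with multiplicity, in nonincreasing order. This list is
   determined by M as soon as char_poly M splits over R, which is the case for
   the transition matrix of a reversible chain whose stationary distribution
   is positive; otherwise it is empty. *)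
Definition eigenvalues (R : realType) (n : nat) (M : 'M[R]_n) : seq R :=
  xget [::] [set s : seq R |
    sorted >=%R s /\ char_poly M = \prod_(a <- s) ('X - a%:P)].

Section Chain.
Variables (R : realType) (C : finite_chain R).

Definition trans_mx : 'M[R]_#|state C| :=
  \matrix_(i, j) trans (enum_val i) (enum_val j).

Definition trans_pow (t : nat) (x y : state C) : R :=
  (trans_mx ^+ t) (enum_rank x) (enum_rank y).

Definition is_lazy : Prop := forall x : state C, 1 / 2 <= trans x x.

Definition is_reversible : Prop :=
  forall x y : state C, stat x * trans x y = stat y * trans y x.

Definition is_irreducible : Prop :=
  forall x y : state C, exists t : nat, 0 < trans_pow t x y.

(* Indexing from 0, the second largest eigenvalue is at position 1. *)
Definition lambda2 : R := (eigenvalues trans_mx)`_1.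

Definition trel : R := (1 - lambda2)^-1.

Definition tv (mu nu : state C -> R) : R := 1 / 2 * \sum_y `|mu y - nu y|.

(* All the maxima below are over nonempty families of nonnegative numbers, so
   that taking 0 as the default value is harmless. *)
Definition dist (t : nat) : R :=
  \big[Num.max/0]_(x : state C) tv (trans_pow t x) (@stat R C).

Definition tmix (eps : R) : nat := min_time (fun t => dist t <= eps).

Definition stat_set (A : {set state C}) : R := \sum_(x in A) stat x.

(* Law of (X_0, ..., X_t) for the chain started at x. *)
Definition path_law (x : state C) (t : nat)
    (E : {set t.+1.-tuple (state C)}) : R :=
  \sum_(w in E | thead w == x)
    \prod_(i < t) trans (tnth w (widen_ord (leqnSn t) i)) (tnth w (lift ord0 i)).

(* On a trajectory w = (X_0, ..., X_t), find (mem A) w is the minimum of T_A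
   and t.+1, so that the event {T_A > t} is t < find (mem A) w. *)
Definition hit_tail (x : state C) (A : {set state C}) (t : nat) : R :=
  path_law x [set w : t.+1.-tuple (state C) | (t < find (mem A) w)%N].

Definition hit_prob (alpha : R) (t : nat) : R :=
  \big[Num.max/0]_(x : state C)
    \big[Num.max/0]_(A : {set state C} | alpha <= stat_set A) hit_tail x A t.

Definition hit (alpha eps : R) : nat :=
  min_time (fun t => hit_prob alpha t <= eps).

End Chain.

Section Sequences.
Variables (R : realType) (C : nat -> finite_chain R).

Definition cutoff : Prop :=
  forall eps : R, 0 < eps < 1 ->
    (tmix (C n) eps)%:R / (tmix (C n) (1 - eps))%:R @[n --> \oo] --> (1 : R).

Definition hit_cutoff (alpha : R) : Prop :=
  forall eps : R, 0 < eps < 1 / 4 ->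
    (fun n => (hit (C n) alpha eps)%:R - (hit (C n) alpha (1 - eps))%:R : R)
      =o_\oo (fun n => (hit (C n) alpha (1 / 4))%:R : R).

Definition trel_negligible : Prop :=
  (fun n => trel (C n)) =o_\oo (fun n => (tmix (C n) (1 / 4))%:R : R).

End Sequences.

(* Main.v *)
Require Import Defs.
From mathcomp Require Import all_boot all_order all_algebra.
From mathcomp Require Import reals.
From mathcomp Require Import complex.
From mathcomp Require Import boolp classical_sets topology normedtype.
From mathcomp Require Import landau sequences exp.
From mathcomp Require Import ring lra.

(* Two comparisons drive the proof. On the one hand, [X_t] lies in A only if A
   has been hit, so that [hit_(1-e)(theta + e) <= tmix(theta)]. On the other
   hand, for every set A the chain has a set G of nearly full measure from which
   the law of [X_k] charges A with mass at least [pi(A) - eta] at all times [k]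
   past a multiple of trel; decomposing at the hitting time of G gives
   [tmix(theta + eta) <= hit_alpha(theta) + K trel]. The measure of G is bounded
   by an L^2 maximal inequality. Since a delay of order trel is harmless, no
   martingale is needed for it: writing [a_k = P^k g], one telescopes
   [a_k^2 - a_(k+1)^2], applies AM-GM to each term, and uses
   [sum_i (i+1) |a_i - a_(i+1)|^2 <= |g|^2], which holds because P >= 0.
   Similarly, survival outside A decays in L^2 at rate [1 - pi(A) / trel], so
   that changing the level alpha costs O(trel). It remains to see that trel is
   negligible under 1) or 2): the second eigenfunction f gives [d(t) >= l^t / 2]
   and, through the hitting time of {f <= 0} (or {f >= 0}), [p(1/2, t) >= l^t]
   with [l = lambda2]; laziness excludes bounded mixing or hitting times. *)

Set Implicit Arguments.
Unset Strict Implicit.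
Unset Printing Implicit Defensive.
Import Order.TTheory GRing.Theory Num.Theory.
Import numFieldNormedType.Exports.
Local Open Scope ring_scope.

(** * Second eigenvalue of a symmetric matrix *)

Section SymmetricMatrix.
Local Open Scope sesquilinear_scope.

(** [P] intertwines the two characteristic matrices, so their determinants agree after
    multiplication by the nonzero [\det Pp]. *)
Lemma char_poly_conj (F : fieldType) n (A B P : 'M[F]_n) :
  P \in unitmx -> P *m A = B *m P -> char_poly A = char_poly B.
Proof.
move=> Pu PAB; pose Pp := map_mx polyC P.
have detP : \det Pp != 0.
  by rewrite /Pp det_map_mx polyC_eq0 -unitfE -unitmxE.
apply: (mulfI detP); rewrite /char_poly -det_mulmx mulrC -det_mulmx.
congr (\det _); rewrite /char_poly_mx mulmxBl mulmxBr -!map_mxM PAB.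
by rewrite scalar_mxC.
Qed.

(** Over [R[i]] the matrix is Hermitian and the spectral theorem applies. Its eigenvalues are real,
    so the factorization of [char_poly S] descends to [R]; only [U] stays complex. *)
Lemma symmetric_unitary_diag (R : rcfType) n (S : 'M[R]_n) : S^T = S ->
  exists (d : 'rV[R]_n) (U : 'M[R[i]]_n),
    [/\ U \is unitarymx, char_poly S = \prod_(i < n) ('X - (d 0 i)%:P)
      & map_mx (real_complex R) S =
          U^t* *m diag_mx (map_mx (real_complex R) d) *m U].
Proof.
move=> symS; pose SC := map_mx (real_complex R) S.
have hermS : SC \is hermsymmx.
  apply/is_hermitianmxP; rewrite expr0 scale1r; apply/matrixP => i j.
  rewrite !mxE -{1}symS mxE; apply/esym/CrealP.
  by apply/complex_realP; exists (S j i).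
pose U := spectralmx SC; pose dC := spectral_diag SC.
have uU : U \is unitarymx := spectral_unitarymx SC.
have /hermitian_normalmx/orthomx_spectralP eqS := hermS.
have dreal i : exists r : R, dC 0 i = real_complex R r.
  have /mxOverP/(_ 0 i) := hermitian_spectral_diag_real hermS.
  by move/complex_realP.
pose d : 'rV[R]_n := \row_i complex.Re (dC 0 i).
have dE : map_mx (real_complex R) d = dC.
  by apply/rowP => i; rewrite !mxE; have [r ->] := dreal i.
exists d, U; split => //; last by rewrite dE -invmx_unitary.
have := map_poly_inj (real_complex R); apply.
rewrite map_char_poly -/SC (@char_poly_conj _ _ SC (diag_mx dC) U).
- rewrite char_poly_trig ?diag_mx_is_trig// rmorph_prod.
  apply: eq_bigr => i _; rewrite rmorphB/= map_polyX map_polyC /=.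
  by rewrite -dE !mxE eqxx mulr1n.
- exact: unitarymx_unit.
- by rewrite eqS -/U !mulmxA mulmxV ?mul1mx// unitarymx_unit.
Qed.

(** * Spectral gap when the eigenvalue 1 is simple *)

Section SpectralGap.
Variables (R : rcfType) (n : nat) (S : 'M[R]_n) (v : 'rV[R]_n) (s : seq R).
Hypotheses (symS : S^T = S) (n_gt1 : (1 < n)%N).
Hypotheses (Sv : v *m S = v) (vN0 : v != 0).
Hypothesis simple1 : forall u, u *m S = u -> exists c, u = c *: v.
Hypothesis S_le1 : forall u : 'rV_n, (u *m S *m u^T) 0 0 <= (u *m u^T) 0 0.
Hypotheses (ss : sorted >=%R s) (charS : char_poly S = \prod_(a <- s) ('X - a%:P)).

Lemma mul_tr_row_ge0 (u : 'rV[R]_n) : 0 <= (u *m u^T) 0 0.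
Proof. by rewrite mxE sumr_ge0// => i _; rewrite mxE -expr2 sqr_ge0. Qed.

Lemma mul_tr_row_gt0 (u : 'rV[R]_n) : u != 0 -> 0 < (u *m u^T) 0 0.
Proof.
move=> uN0; rewrite lt_neqAle mul_tr_row_ge0 andbT eq_sym.
apply: contra_neq uN0; rewrite mxE => u0; apply/rowP => i; rewrite mxE.
move/eqP: u0; rewrite psumr_eq0; last by move=> j _; rewrite mxE -expr2 sqr_ge0.
by move=> /allP/(_ i (mem_index_enum _)); rewrite mxE -expr2 sqrf_eq0 => /eqP.
Qed.

Let size_s : size s = n.
Proof. by have := size_char_poly S; rewrite charS size_prod_XsubC => -[]. Qed.

Let eig_mem a : eigenvalue S a = (a \in s).
Proof. by rewrite eigenvalue_root_char charS root_prod_XsubC. Qed.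

Let s_le1 a : a \in s -> a <= 1.
Proof.
rewrite -eig_mem => /eigenvalueP[u uS uN0].
have := S_le1 u; rewrite uS -scalemxAl mxE.
by rewrite -{2}[(u *m _) 0 0]mul1r ler_pM2r ?mul_tr_row_gt0.
Qed.

Let s_nth_le i j : (i <= j)%N -> (j < size s)%N -> s`_j <= s`_i.
Proof.
move=> ij js.
have ge_tr : transitive (>=%R : rel R) by move=> x y z yx zy; exact: le_trans zy yx.
by apply: (sorted_leq_nth ge_tr (lexx : reflexive >=%R) 0 ss) => //; rewrite inE (leq_ltn_trans ij).
Qed.

Let s01 : s`_0 = 1.
Proof.
have : 1 \in s by rewrite -eig_mem; apply/eigenvalueP; exists v; rewrite ?scale1r.
case/(nthP 0) => i ilt s1; apply/le_anti/andP; split.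
  by apply/s_le1/mem_nth; rewrite size_s ltnW.
by rewrite -s1 s_nth_le.
Qed.

Let s_le a : a \in s -> a != 1 -> a <= s`_1.
Proof.
case/(nthP 0) => -[|i] ilt <-; first by rewrite s01 eqxx.
by move=> _; rewrite s_nth_le.
Qed.

(* An eigenvector of a real matrix for a real eigenvalue has real and imaginary
   parts that are eigenvectors too, so that the rows of the unitary matrix for
   the eigenvalue 1 are complex multiples of [v]. *)
Let row_prop (d : 'rV[R]_n) (U : 'M[R[i]]_n) i : U \is unitarymx ->
  map_mx (real_complex R) S = U^t* *m diag_mx (map_mx (real_complex R) d) *m U ->
  d 0 i = 1 -> exists c : R[i], row i U = c *: map_mx (real_complex R) v.
Proof.
move=> uU eqS d1; pose r := row i U.
have rS : r *m map_mx (real_complex R) S = r.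
  rewrite eqS !mulmxA -row_mul (unitarymxP uU) row1 -rowE row_diag_mx.
  by rewrite mxE d1 scale1r -rowE.
pose re : 'rV[R]_n := map_mx (@complex.Re R) r; pose im : 'rV[R]_n := map_mx (@complex.Im R) r.
have sumRe (F : 'I_n -> R[i]) : complex.Re (\sum_j F j) = \sum_j complex.Re (F j).
  by apply: (big_morph (@complex.Re R)) => // -[a b] [a' b'].
have sumIm (F : 'I_n -> R[i]) : complex.Im (\sum_j F j) = \sum_j complex.Im (F j).
  by apply: (big_morph (@complex.Im R)) => // -[a b] [a' b'].
have reS : re *m S = re.
  apply/rowP => j; move/rowP: rS => /(_ j)/(congr1 (@complex.Re R)).
  rewrite !mxE sumRe => <-; apply: eq_bigr => k _; rewrite !mxE.
  by case: (U i k) => a b /=; rewrite mulr0 subr0.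
have imS : im *m S = im.
  apply/rowP => j; move/rowP: rS => /(_ j)/(congr1 (@complex.Im R)).
  rewrite !mxE sumIm => <-; apply: eq_bigr => k _; rewrite !mxE.
  by case: (U i k) => a b /=; rewrite mulr0 add0r.
have [a reE] := simple1 reS; have [b imE] := simple1 imS.
exists (a +i* b)%C; apply/rowP => j; rewrite !mxE.
move/rowP: reE => /(_ j); rewrite !mxE; move/rowP: imE => /(_ j); rewrite !mxE.
by case: (U i j) => x y /= -> ->; rewrite /GRing.mul /= !mulr0 subr0 add0r.
Qed.

(** If the first two entries of [s] were 1, two distinct rows of [U] would be multiples of the same
    vector [v], against orthonormality. *)
Lemma second_eigenvalue_lt1 : s`_1 < 1.
Proof.
have s1in : s`_1 \in s by rewrite mem_nth ?size_s.
rewrite lt_neqAle s_le1// andbT; apply/negP => /eqP s11.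
have [d [U [uU charD eqS]]] := symmetric_unitary_diag symS.
have perm_sd : perm_eq s [seq d 0 i | i : 'I_n].
  by apply: prod_XsubC_eq; rewrite -charS charD big_map big_enum.
(* [s] and the diagonal [d] have the same entries up to order, so 1 occurs at least twice in [d]. *)
have /card_gt1P[i [j [i1 j1 ij]]] : (1 < #|[pred i | d 0%R i == 1%R]|)%N.
  rewrite cardE -[X in (_ < X)%N](size_map (fun i => d 0%R i)).
  have -> : [seq d 0 i | i <- enum [pred i | d 0 i == 1]] =
     [seq x <- [seq d 0 i | i : 'I_n] | x == 1].
    by rewrite filter_map enumT.
  rewrite -(perm_size (perm_filter _ perm_sd)) size_filter.
  move: s01 s11 n_gt1 size_s; case: (s) => [|a [|b s']] /=.
  - by move=> _ _ + E; rewrite -E.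
  - by move=> _ _ + E; rewrite -E.
  - by move=> -> -> _ _; rewrite eqxx.
move: i1 j1; rewrite !inE => /eqP i1 /eqP j1.
have [a ra] := row_prop uU eqS i1; have [b rb] := row_prop uU eqS j1.
have /row_unitarymxP orth := uU.
have := orth i j; have := orth i i; have := orth j j.
rewrite !eqxx (negPf ij) !dotmxE ra rb.
set w := map_mx _ _.
have E x y : (x *: w *m (y *: w)^t*) 0 0 = x * (y^* * (w *m w^t*) 0 0).
  by rewrite linearZ /= map_mxZ -scalemxAl -scalemxAr !mxE.
rewrite !E => Hb Ha /eqP; rewrite !mulf_eq0 conjC_eq0 => /or3P[]/eqP H0.
- by move: Ha; rewrite H0 !mul0r => /eqP; rewrite eq_sym oner_eq0.
- by move: Hb; rewrite H0 !mul0r => /eqP; rewrite eq_sym oner_eq0.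
- by move: Hb; rewrite H0 !mulr0 => /eqP; rewrite eq_sym oner_eq0.
Qed.

Lemma second_eigenvalue_eigenvector : exists2 u : 'rV_n, u *m S = s`_1 *: u & u != 0.
Proof. by apply/eigenvalueP; rewrite eig_mem mem_nth ?size_s. Qed.

(** Expand [u] in the orthonormal rows of [U]: the coordinates for the eigenvalue 1 vanish because
    those rows are multiples of [v], and every other eigenvalue is at most the second entry of
    [s]. *)
Lemma second_eigenvalue_rayleigh (u : 'rV_n) : (u *m v^T) 0 0 = 0 ->
  (u *m S *m u^T) 0 0 <= s`_1 * (u *m u^T) 0 0.
Proof.
move=> uv0; have [d [U [uU charD eqS]]] := symmetric_unitary_diag symS.
rewrite -lecR.
pose z := map_mx (real_complex R) u *m U^t*.
have uT : map_mx (real_complex R) u^T = (map_mx (real_complex R) u)^t*.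
  apply/matrixP => i j; rewrite !mxE; apply/esym/CrealP.
  by apply/complex_realP; eexists.
have zT : U *m map_mx (real_complex R) u^T = z^t*.
  by rewrite uT /z trmx_mul map_mxM/= trmxCK.
have zU : map_mx (real_complex R) u = z *m U.
  by rewrite /z -mulmxA -invmx_unitary// mulVmx ?mulmx1 ?unitarymx_unit.
have zi i : z 0 i = (map_mx (real_complex R) u *m (row i U)^t*) 0 0.
  by rewrite !mxE; apply: eq_bigr => j _; rewrite !mxE.
move: (z) zT zU zi (erefl : map_mx (real_complex R) u *m U^t* = z) => {}z zT zU zi zE.
have q1 : (real_complex R) ((u *m S *m u^T) 0 0) =
    \sum_i (real_complex R (d 0 i)) * `|z 0 i| ^+ 2.
  transitivity (map_mx (real_complex R) (u *m S *m u^T) 0 0); first by rewrite [RHS]mxE.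
  rewrite !map_mxM /= eqS !mulmxA zE -mulmxA zT mxE; apply: eq_bigr => i _.
  by rewrite mul_mx_diag !mxE normCK mulrA [z 0 i * _]mulrC.
have q2 : (real_complex R) ((u *m u^T) 0 0) = \sum_i `|z 0 i| ^+ 2.
  transitivity (map_mx (real_complex R) (u *m u^T) 0 0); first by rewrite [RHS]mxE.
  rewrite map_mxM /= zU -[_ *m map_mx _ _]mulmxA zT mxE; apply: eq_bigr => i _.
  by rewrite !mxE normCK.
rewrite rmorphM /= q1 q2 mulr_sumr; apply: ler_sum => i _.
have [d1|dN1] := eqVneq (d 0 i) 1; last first.
  rewrite ler_wpM2r ?exprn_ge0 ?normr_ge0// lecR s_le//.
  rewrite -root_prod_XsubC -charS charD.
  by rewrite (bigD1 i) //= rootM root_XsubC eqxx.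
have [c rc] := row_prop uU eqS d1.
suff -> : z 0 i = 0 by rewrite normr0 expr0n /= !mulr0.
rewrite zi rc linearZ /= map_mxZ -scalemxAr mxE.
have -> : (map_mx (real_complex R) v)^t* = map_mx (real_complex R) v^T.
  apply/matrixP => k j; rewrite !mxE; apply/CrealP.
  by apply/complex_realP; eexists.
by rewrite -map_mxM mxE uv0 rmorph0 mulr0.
Qed.

End SpectralGap.

End SymmetricMatrix.

(** * Transition operator and hitting times *)

Section Operators.
Variables (R : realType) (C : finite_chain R).
Local Notation T := (state C).
Local Notation pi := (@stat R C).
Local Notation P := (@trans R C).
Implicit Types (f g h : T -> R) (A B : {set T}) (x y z : T).

Definition markov_op f x : R := \sum_y P x y * f y.
Definition stat_dot f g : R := \sum_x pi x * (f x * g x).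

Local Notation avg := markov_op.

Lemma avg_const (c : R) : avg (fun=> c) = (fun=> c).
Proof. by apply: funext => x; rewrite /avg -mulr_suml trans_sum1 mul1r. Qed.

Lemma iter_avg_const t (c : R) : iter t avg (fun=> c) = (fun=> c).
Proof. by elim: t => //= t ->; rewrite avg_const. Qed.

Lemma avgB f g : avg (fun x => f x - g x) = (fun x => avg f x - avg g x).
Proof.
by apply: funext => x; rewrite /avg -sumrB; apply: eq_bigr => y _; rewrite mulrBr.
Qed.

Lemma avg_ge0 f x : (forall y, 0 <= f y) -> 0 <= avg f x.
Proof. by move=> f0; apply: sumr_ge0 => y _; rewrite mulr_ge0 ?trans_ge0. Qed.

Lemma avg_le f g x : (forall y, f y <= g y) -> avg f x <= avg g x.
Proof. by move=> fg; apply: ler_sum => y _; rewrite ler_wpM2l ?trans_ge0. Qed.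

Lemma trans_pow0 x y : trans_pow 0 x y = (x == y)%:R.
Proof. by rewrite /trans_pow expr0 -[1]/(1%:M) mxE (inj_eq enum_rank_inj). Qed.

Lemma trans_powS t x y : trans_pow t.+1 x y = \sum_z P x z * trans_pow t z y.
Proof.
rewrite /trans_pow exprS -[_ * _]/(_ *m _) mxE.
rewrite (reindex enum_rank) /=; last by apply: onW_bij; exact: enum_rank_bij.
by apply: eq_bigr => z _; rewrite mxE !enum_rankK.
Qed.

Lemma iter_avgE t f x : iter t avg f x = \sum_y trans_pow t x y * f y.
Proof.
elim: t x => [|t IH] x /=.
  rewrite (bigD1 x) //= trans_pow0 eqxx mul1r big1 ?addr0// => y yx.
  by rewrite trans_pow0 eq_sym (negPf yx) mul0r.
have -> : avg (iter t avg f) x = \sum_z \sum_y P x z * (trans_pow t z y * f y).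
  by apply: eq_bigr => z _; rewrite IH mulr_sumr.
rewrite exchange_big /=; apply: eq_bigr => y _; rewrite trans_powS mulr_suml.
by apply: eq_bigr => z _; rewrite mulrA.
Qed.

Lemma trans_pow_ge0 t x y : 0 <= trans_pow t x y.
Proof.
elim: t x => [|t IH] x; first by rewrite trans_pow0 ler0n.
by rewrite trans_powS sumr_ge0// => z _; rewrite mulr_ge0 ?trans_ge0.
Qed.

Lemma trans_pow_sum1 t x : \sum_y trans_pow t x y = 1.
Proof.
have := iter_avgE t (fun=> 1) x; under eq_bigr do rewrite mulr1.
by move=> <-; rewrite iter_avg_const.
Qed.

Lemma stat_avg f : \sum_x pi x * avg f x = \sum_x pi x * f x.
Proof.
rewrite /avg; under eq_bigr => x _ do rewrite mulr_sumr.
rewrite exchange_big /=; apply: eq_bigr => y _.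
by rewrite -(stat_invariant y) mulr_suml; apply: eq_bigr => x _; rewrite mulrA.
Qed.

Lemma stat_iter_avg t f : \sum_x pi x * iter t avg f x = \sum_x pi x * f x.
Proof. by elim: t => //= t IH; rewrite stat_avg. Qed.

Lemma lazy_trans_pow t x : is_lazy C -> (1 / 2) ^+ t <= trans_pow t x x.
Proof.
move=> lazyC; elim: t => [|t IH]; first by rewrite trans_pow0 eqxx expr0.
rewrite trans_powS (bigD1 x) //= exprS -[leLHS]addr0 lerD//.
  by rewrite ler_pM// ?exprn_ge0// divr_ge0.
by rewrite sumr_ge0// => z _; rewrite mulr_ge0 ?trans_ge0 ?trans_pow_ge0.
Qed.

Lemma stat_set_le1 A : stat_set A <= 1.
Proof.
rewrite -(stat_sum1 C) /stat_set [leRHS](bigID (mem A)) /= lerDl.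
by rewrite sumr_ge0// => x _; exact: stat_ge0.
Qed.

Lemma stat_setC A : stat_set (~: A) = 1 - stat_set A.
Proof.
rewrite -(stat_sum1 C) /stat_set [X in X - _](bigID (mem A)) /= addrAC subrr add0r.
by apply: eq_bigl => x; rewrite inE.
Qed.

Lemma stat_set_ge0 A : 0 <= stat_set A.
Proof. by rewrite sumr_ge0// => x _; exact: stat_ge0. Qed.

(** Markov's inequality, read on the complementary event. *)
Lemma stat_set_markov f (c : R) : 0 < c -> (forall x, 0 <= f x) ->
  1 - (\sum_x pi x * f x) / c <= stat_set [set x | f x <= c].
Proof.
move=> c0 f0; rewrite -[stat_set _]opprK -[- stat_set _]addr0 -{2}(subrr 1).
rewrite [- _ + _]addrA [- _ + 1]addrC -stat_setC opprB lerB//.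
rewrite ler_pdivlMr// /stat_set mulr_suml [leRHS](bigID (mem (~: [set x | f x <= c]))) /=.
rewrite -[leLHS]addr0 lerD//.
  apply: ler_sum => x; rewrite !inE -ltNge => /ltW cf.
  by rewrite ler_wpM2l ?stat_ge0.
by rewrite sumr_ge0// => x _; rewrite mulr_ge0 ?stat_ge0.
Qed.

(** * Survival probabilities and decompositions at hitting times *)

Lemma hit_tail0 x A : hit_tail x A 0 = (x \notin A)%:R.
Proof.
rewrite /hit_tail /path_law; case: (boolP (x \in A)) => xA /=.
  rewrite big_pred0// => w; apply/negP => /andP[+ /eqP xw]; rewrite inE.
  by move: xA; rewrite -xw; case/tupleP: w {xw} => y w; rewrite theadE /= => ->.
rewrite (big_pred1 [tuple x]) ?big_ord0// => w /=; rewrite inE.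
case/tupleP: w => y w; rewrite theadE (tuple0 w) /=.
apply/andP/eqP => [[_ /eqP ->]|]; first exact: val_inj.
by move=> /(congr1 (@thead _ _)); rewrite !theadE => ->; rewrite (negPf xA).
Qed.

(** First-step analysis on trajectories: those starting at [x] are indexed by their tails, which are
    then grouped by their own first state. *)
Lemma hit_tailS x A t :
  hit_tail x A t.+1 = (x \notin A)%:R * avg (fun y => hit_tail y A t) x.
Proof.
pose K (w : t.+1.-tuple T) : R :=
  \prod_(i < t) P (tnth w (widen_ord (leqnSn t) i)) (tnth w (lift ord0 i)).
transitivity (\sum_(w : t.+1.-tuple T | (x \notin A) && (t < find (mem A) w)%N)
    P x (thead w) * K w).
  rewrite /hit_tail /path_law.
  rewrite (reindex_onto (fun w : t.+1.-tuple T => [tuple of x :: w])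
    (fun w => [tuple of behead w])) /=; last first.
    by move=> w /andP[_ /eqP <-]; rewrite -tuple_eta.
  apply: eq_big => [w|w _].
    rewrite !inE theadE eqxx andbT /=.
    have -> : [tuple of behead [tuple of x :: w]] == w by apply/eqP/val_inj.
    by rewrite andbT; case: (x \in A).
  rewrite big_ord_recl; congr (_ * _).
    by rewrite !(tnth_nth x) /= -[thead w]/(tnth w ord0) (tnth_nth x).
  by apply: eq_bigr => i _; rewrite !(tnth_nth x).
case: (x \notin A) => /=; last by rewrite big_pred0// mul0r.
rewrite mul1r (partition_big (@thead _ _) predT) //=; apply: eq_bigr => y _.
rewrite /hit_tail /path_law mulr_sumr; apply: eq_big => [w|w /andP[_ /eqP ->//]].
by rewrite inE.
Qed.

Lemma hit_tail_ge0 x A t : 0 <= hit_tail x A t.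
Proof.
elim: t x => [|t IH] x; first by rewrite hit_tail0 ler0n.
by rewrite hit_tailS mulr_ge0 ?ler0n// avg_ge0.
Qed.

Lemma hit_tail_in x A t : x \in A -> hit_tail x A t = 0.
Proof. by case: t => [|t] xA; rewrite ?hit_tail0 ?hit_tailS xA ?mul0r. Qed.

Lemma hit_tail_notin x A t : x \notin A ->
  hit_tail x A t.+1 = avg (fun y => hit_tail y A t) x.
Proof. by move=> xA; rewrite hit_tailS xA mul1r. Qed.

Lemma hit_tail_le1 x A t : hit_tail x A t <= 1.
Proof.
elim: t x => [|t IH] x; first by rewrite hit_tail0 lern1 leq_b1.
have [xA|xA] := boolP (x \in A); first by rewrite hit_tail_in.
by rewrite hit_tail_notin// -[leRHS]/((fun=> 1) x) -avg_const avg_le.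
Qed.

Lemma hit_tail_decr x A t : hit_tail x A t.+1 <= hit_tail x A t.
Proof.
elim: t x => [|t IH] x.
  have [xA|xA] := boolP (x \in A); first by rewrite !hit_tail_in.
  by rewrite hit_tail0 xA hit_tail_le1.
have [xA|xA] := boolP (x \in A); first by rewrite !hit_tail_in.
by rewrite !(hit_tail_notin _ xA) avg_le.
Qed.

Lemma hit_tail_mono x A s t : (s <= t)%N -> hit_tail x A t <= hit_tail x A s.
Proof.
move=> /subnK <-; elim: (t - s)%N => // k IH.
by rewrite addSn (le_trans (hit_tail_decr _ _ _)).
Qed.

(* Decomposition at the hitting time of B. *)
Lemma hit_tail_through A B s (delta : R) x t :
  (forall y, y \in B -> hit_tail y A s <= delta) -> 0 <= delta ->
  hit_tail x A (t + s) <= hit_tail x B t + delta.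
Proof.
move=> HB d0; elim: t x => [|t IH] x.
  have [xB|xB] := boolP (x \in B); first by rewrite (hit_tail_in _ xB) add0r HB.
  by rewrite hit_tail0 xB (le_trans (hit_tail_le1 _ _ _))// lerDl.
have [xB|xB] := boolP (x \in B).
  rewrite (hit_tail_in _ xB) add0r (le_trans _ (HB _ xB))// hit_tail_mono//.
  by rewrite leq_addl.
have [xA|xA] := boolP (x \in A).
  by rewrite (hit_tail_in _ xA) addr_ge0// hit_tail_ge0.
rewrite addSn !hit_tail_notin// (le_trans (avg_le _ IH))// /avg.
under eq_bigr do rewrite mulrDr.
by rewrite big_split /= -mulr_suml trans_sum1 mul1r.
Qed.

(** Markov property at the hitting time of [B]: if [B] is hit by time [t], the time left lies in
    [[s, N]], where the average of [f] is at least [c]. The other paths contribute a nonnegative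
    amount. *)
Lemma iter_avg_through B f (c : R) s N x t : 0 <= c -> (forall y, 0 <= f y) ->
  (forall y k, y \in B -> (s <= k <= N)%N -> c <= iter k avg f y) ->
  (t + s <= N)%N ->
  c * (1 - hit_tail x B t) <= iter (t + s) avg f x.
Proof.
move=> c0 f0 HB; have pf0 k y : 0 <= iter k avg f y.
  by elim: k y => // k IH y; exact: avg_ge0.
elim: t x => [|t IH] x tN; have [xB|xB] := boolP (x \in B).
- by rewrite (hit_tail_in _ xB) subr0 mulr1 HB// leqnn.
- by rewrite hit_tail0 xB subrr mulr0.
- by rewrite (hit_tail_in _ xB) subr0 mulr1 HB// leq_addl.
rewrite hit_tail_notin// addSn /=.
apply: le_trans (avg_le _ (fun y => IH y (ltnW tN))) => //.
rewrite le_eqVlt; apply/orP; left; apply/eqP.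
rewrite /avg -[X in c * (X - _)](trans_sum1 x) -sumrB mulr_sumr.
by apply: eq_bigr => y _; ring.
Qed.

Lemma iter_avg_indicator t A x :
  iter t avg (fun y => (y \in A)%:R) x = \sum_(y in A) trans_pow t x y.
Proof.
rewrite iter_avgE [RHS]big_mkcond; apply: eq_bigr => y _.
by case: (y \in A); rewrite ?mulr1 ?mulr0.
Qed.

(** The events [T_A > t] and [X_t] in [A] are disjoint. *)
Lemma hit_tail_avoid t A x : hit_tail x A t <= 1 - \sum_(y in A) trans_pow t x y.
Proof.
rewrite -iter_avg_indicator lerBrDr; elim: t x => [|t IH] x /=.
  by rewrite hit_tail0; case: (x \in A); rewrite ?addr0 ?add0r.
have [xA|xA] := boolP (x \in A).
  rewrite hit_tail_in// add0r -[leRHS]/((fun=> 1) x) -avg_const avg_le// => y.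
  by apply: le_trans (IH y); rewrite lerDr hit_tail_ge0.
rewrite hit_tail_notin// /avg -big_split /=.
rewrite -[leRHS]/((fun=> 1) x) -avg_const ler_sum// => y _.
by rewrite -mulrDr ler_wpM2l ?trans_ge0.
Qed.

Lemma hit_tail_lazy t A x : is_lazy C -> x \notin A ->
  (1 / 2) ^+ t <= hit_tail x A t.
Proof.
move=> lazyC xA; elim: t => [|t IH]; first by rewrite hit_tail0 xA expr0.
rewrite hit_tail_notin// /avg (bigD1 x) //= exprS -[leLHS]addr0 lerD//.
  by rewrite ler_pM// ?exprn_ge0// divr_ge0.
by rewrite sumr_ge0// => z _; rewrite mulr_ge0 ?trans_ge0 ?hit_tail_ge0.
Qed.

(** Since the total masses agree, adding half of [sum (nu - mu) = 0] turns half the absolute value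
    into the positive part of [nu - mu]. *)
Lemma sum_diff_le_tv (mu nu : T -> R) A : \sum_y mu y = \sum_y nu y ->
  \sum_(y in A) (nu y - mu y) <= tv mu nu.
Proof.
move=> munu; have s0 : \sum_y (nu y - mu y) = 0 by rewrite sumrB munu subrr.
rewrite /tv; have -> : 1 / 2 * \sum_y `|mu y - nu y| =
    \sum_y (1 / 2 * (`|mu y - nu y| + (nu y - mu y))).
  by rewrite -mulr_sumr big_split /= s0 addr0.
rewrite big_mkcond; apply: ler_sum => y _.
have := ler_norm (mu y - nu y); have := ler_norm (nu y - mu y).
by rewrite distrC; case: (y \in A); lra.
Qed.

Lemma tv_eq_sum_diff (mu nu : T -> R) : \sum_y mu y = \sum_y nu y ->
  tv mu nu = \sum_(y in [set y | mu y < nu y]) (nu y - mu y).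
Proof.
move=> munu; have s0 : \sum_y (nu y - mu y) = 0 by rewrite sumrB munu subrr.
rewrite /tv; have -> : 1 / 2 * \sum_y `|mu y - nu y| =
    \sum_y (1 / 2 * (`|mu y - nu y| + (nu y - mu y))).
  by rewrite -mulr_sumr big_split /= s0 addr0.
rewrite [RHS]big_mkcond; apply: eq_bigr => y _; rewrite inE.
by case: ltP => h; [rewrite ler0_norm|rewrite ger0_norm]; lra.
Qed.

Lemma tv_le_dist t x : tv (trans_pow t x) pi <= dist C t.
Proof. exact: (le_bigmax _ (fun x => tv (trans_pow t x) pi)). Qed.

Lemma dist_le t (e : R) : 0 <= e -> (forall x, tv (trans_pow t x) pi <= e) ->
  dist C t <= e.
Proof. by move=> e0 H; apply: bigmax_le. Qed.

Lemma hit_tail_le_prob (alpha : R) t x A : alpha <= stat_set A ->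
  hit_tail x A t <= hit_prob C alpha t.
Proof.
move=> aA; rewrite /hit_prob.
apply: le_trans (le_bigmax _ (fun x => \big[Num.max/0]_(A | alpha <= stat_set A) hit_tail x A t) x).
exact: (le_bigmax_cond _ (fun A => hit_tail x A t)).
Qed.

Lemma hit_prob_le (alpha : R) t (e : R) : 0 <= e ->
  (forall x A, alpha <= stat_set A -> hit_tail x A t <= e) ->
  hit_prob C alpha t <= e.
Proof. by move=> e0 H; apply: bigmax_le => // x _; apply: bigmax_le => // A /H. Qed.

Lemma hit_prob_ge0 (alpha : R) t : 0 <= hit_prob C alpha t.
Proof. exact: bigmax_ge_id. Qed.

Lemma hit_prob_anti (alpha beta : R) t : alpha <= beta ->
  hit_prob C beta t <= hit_prob C alpha t.
Proof.
move=> ab; apply: hit_prob_le => [|x A bA]; first exact: hit_prob_ge0.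
by apply: hit_tail_le_prob; exact: le_trans ab bA.
Qed.

Lemma hit_prob_le_dist (e : R) t : 0 <= e ->
  hit_prob C (1 - e) t <= dist C t + e.
Proof.
move=> e0; have d0 : 0 <= dist C t by exact: bigmax_ge_id.
apply: hit_prob_le => [|x A eA]; first exact: addr_ge0.
apply: le_trans (hit_tail_avoid _ _ _) _.
have tvA : \sum_(y in A) (pi y - trans_pow t x y) <= tv (trans_pow t x) pi.
  by apply: sum_diff_le_tv; rewrite trans_pow_sum1 stat_sum1.
move: tvA; rewrite sumrB -/(stat_set A) => tvA.
by have := tv_le_dist t x; lra.
Qed.

End Operators.

(** * Spectral gap of a reversible chain *)

Section Reversible.
Variables (R : realType) (C : finite_chain R).
Hypotheses (lazyC : is_lazy C) (reversibleC : is_reversible C).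
Hypothesis irreducibleC : is_irreducible C.
Local Notation T := (state C).
Local Notation pi := (@stat R C).
Local Notation P := (@trans R C).
Local Notation avg := (@markov_op R C).
Local Notation dot := (@stat_dot R C).
Implicit Types (f g h : T -> R) (A B : {set T}) (x y z : T).

(** Some state [x] carries mass, and invariance of [pi] under [P^t], for a [t] at which [y] is
    reachable from [x], passes mass on to [y]. *)
Lemma stat_gt0 y : 0 < pi y.
Proof.
have [x x0] : exists x, 0 < pi x.
  apply/existsP; apply: contraT; rewrite negb_exists => /forallP H.
  have : \sum_x pi x <= 0 by rewrite sumr_le0// => x _; rewrite leNgt.
  by rewrite stat_sum1 ler10.
have [t tpos] := irreducibleC x y.
have : \sum_x pi x * trans_pow t x y = pi y.
  have := stat_iter_avg t (fun z : T => (z == y)%:R).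
  have E (F : T -> R) : \sum_z F z * (z == y)%:R = F y.
    rewrite (bigD1 y) //= eqxx mulr1 big1 ?addr0// => z zy.
    by rewrite (negPf zy) mulr0.
  by rewrite E => <-; apply: eq_bigr => z _; rewrite iter_avgE E.
move=> <-; rewrite (bigD1 x) //= ltr_wpDr ?mulr_gt0// sumr_ge0// => z _.
by rewrite mulr_ge0 ?stat_ge0 ?trans_pow_ge0.
Qed.

Lemma dotC f g : dot f g = dot g f.
Proof. by apply: eq_bigr => x _; rewrite [f x * _]mulrC. Qed.

Lemma dotBl f g h : dot (fun x => f x - g x) h = dot f h - dot g h.
Proof. by rewrite /stat_dot -sumrB; apply: eq_bigr => x _; ring. Qed.

Lemma dotBr f g h : dot h (fun x => f x - g x) = dot h f - dot h g.
Proof. by rewrite dotC dotBl !(dotC h). Qed.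

Lemma dot_ge0 f : 0 <= dot f f.
Proof.
by apply: sumr_ge0 => x _; rewrite mulr_ge0 ?stat_ge0// -expr2 sqr_ge0.
Qed.

Lemma dot_avgE f g : dot (avg f) g = \sum_x \sum_y pi x * P x y * (f y * g x).
Proof.
apply: eq_bigr => x _; rewrite /markov_op mulr_suml mulr_sumr.
by apply: eq_bigr => y _; ring.
Qed.

Lemma dot_avg_sym f g : dot (avg f) g = dot f (avg g).
Proof.
rewrite [RHS]dotC !dot_avgE exchange_big /=; apply: eq_bigr => x _.
by apply: eq_bigr => y _; rewrite reversibleC; ring.
Qed.

Lemma sum_edge_diag f : \sum_x \sum_y pi x * P x y * (f x * f x) = dot f f.
Proof.
apply: eq_bigr => x _; rewrite -mulr_suml -mulr_sumr trans_sum1.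
by rewrite mulr1.
Qed.

Lemma sum_edge_diag' f : \sum_x \sum_y pi x * P x y * (f y * f y) = dot f f.
Proof.
rewrite exchange_big /= -[RHS]sum_edge_diag; apply: eq_bigr => x _.
by apply: eq_bigr => y _; rewrite reversibleC.
Qed.

(** The Dirichlet form: it yields [P <= 1] as quadratic forms, and it vanishes only on functions
    that are constant along possible transitions. *)
Lemma dirichletE f :
  \sum_x \sum_y pi x * P x y * (f x - f y) ^+ 2 = 2 * (dot f f - dot (avg f) f).
Proof.
transitivity (dot f f + dot f f - 2 * dot (avg f) f); last by ring.
rewrite -{1}sum_edge_diag -sum_edge_diag' dot_avgE mulr_sumr -big_split -sumrB /=.
apply: eq_bigr => x _; rewrite mulr_sumr -big_split -sumrB /=.
by apply: eq_bigr => y _; ring.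
Qed.

Lemma dot_avg_le f : dot (avg f) f <= dot f f.
Proof.
rewrite -subr_ge0 -(pmulr_rge0 _ (ltr0Sn R 1)) -dirichletE.
apply: sumr_ge0 => x _; apply: sumr_ge0 => y _.
by rewrite mulr_ge0 ?sqr_ge0// mulr_ge0 ?stat_ge0 ?trans_ge0.
Qed.

(* [P - 1/2] has nonnegative entries, so its quadratic form is at least
   [- 1/2] times that of the identity. *)
Lemma dot_avg_ge0 f : 0 <= dot (avg f) f.
Proof.
rewrite -(pmulr_rge0 _ (ltr0Sn R 1)).
have -> : 2 * dot (avg f) f = \sum_x \sum_y
    (pi x * P x y - (1 / 2) * (x == y)%:R * pi x) * (f x + f y) ^+ 2.
  transitivity (dot f f + dot f f + 2 * dot (avg f) f - 2 * dot f f); first by ring.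
  rewrite -{1}sum_edge_diag -{1}sum_edge_diag' dot_avgE !mulr_sumr -!big_split -sumrB /=.
  apply: eq_bigr => x _.
  have -> : 2 * (pi x * (f x * f x)) =
      \sum_y (1 / 2) * (x == y)%:R * pi x * (f x + f y) ^+ 2.
    rewrite (bigD1 x) //= eqxx mulr1 big1 => [|y yx]; first by rewrite addr0; field.
    by rewrite eq_sym (negPf yx) mulr0 !mul0r.
  rewrite mulr_sumr -!big_split -sumrB /=; apply: eq_bigr => y _.
  by ring.
apply: sumr_ge0 => x _; apply: sumr_ge0 => y _; rewrite mulr_ge0 ?sqr_ge0//.
rewrite [_ * pi x]mulrC -mulrBr mulr_ge0 ?stat_ge0// subr_ge0.
have [<-|xy] := eqVneq x y; first by rewrite mulr1 lazyC.
by rewrite mulr0 trans_ge0.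
Qed.

(* [P^2 <= P] because [P - P^2 = (1 - P) P (1 - P) + P (1 - P) P]. *)
Lemma dot_avg2_le f : dot (avg f) (avg f) <= dot (avg f) f.
Proof.
have := dot_avg_ge0 (fun x => f x - avg f x); have := dot_avg_le (avg f).
rewrite avgB !dotBl !dotBr !dot_avg_sym => h1 h2.
by lra.
Qed.

(** The Dirichlet form of [f] is zero, so [f] agrees at both ends of each transition of positive
    probability, and irreducibility joins any two states by such transitions. *)
Lemma avg_fixed_const f : avg f = f -> forall x y, f x = f y.
Proof.
move=> Pf x y; have := dirichletE f; rewrite Pf subrr mulr0 => /eqP.
rewrite psumr_eq0; last first.
  move=> z _; apply: sumr_ge0 => w _.
  by rewrite mulr_ge0 ?sqr_ge0// mulr_ge0 ?stat_ge0 ?trans_ge0.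
move=> /allP H; have step z w : 0 < P z w -> f z = f w.
  move=> zw; have := H z (mem_index_enum _) => /=.
  rewrite psumr_eq0; last first.
    by move=> k _; rewrite mulr_ge0 ?sqr_ge0// mulr_ge0 ?stat_ge0 ?trans_ge0.
  move=> /allP/(_ w (mem_index_enum _)) /=.
  rewrite !mulf_eq0 (gt_eqF (stat_gt0 z)) (gt_eqF zw) /= orbb subr_eq0.
  by move=> /eqP.
have [t] := irreducibleC x y; elim: t x => [|t IH] x.
  by rewrite trans_pow0; case: eqP => [->//|_]; rewrite ltxx.
rewrite trans_powS => pos; have [z] : exists z, 0 < P x z * trans_pow t z y.
  apply/existsP; apply: contraLR pos; rewrite negb_exists => /forallP N.
  by rewrite -leNgt sumr_le0// => z _; rewrite leNgt.
move=> pz; have tz : 0 < trans_pow t z y.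
  rewrite lt_neqAle trans_pow_ge0 andbT eq_sym.
  by apply: contraTneq pz => ->; rewrite mulr0 ltxx.
rewrite (step x z) ?IH// lt_neqAle trans_ge0 andbT eq_sym.
by apply: contraTneq pz => ->; rewrite mul0r ltxx.
Qed.

(* Symmetrization: in the coordinates [sqrt (pi x) * f x], the inner product of
   L^2(pi) is the standard one and [P] is symmetric. *)
Let sq x := Num.sqrt (pi x).
Let sq_gt0 x : 0 < sq x. Proof. by rewrite sqrtr_gt0 stat_gt0. Qed.
Let sqE x : sq x * sq x = pi x.
Proof. by rewrite -expr2 sqr_sqrtr// stat_ge0. Qed.
Let S : 'M[R]_#|T| :=
  \matrix_(i, j) (sq (enum_val i) * P (enum_val i) (enum_val j) / sq (enum_val j)).
Let vec f : 'rV[R]_#|T| := \row_i (sq (enum_val i) * f (enum_val i)).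

Let sum_enum (F : T -> R) : \sum_(i < #|T|) F (enum_val i) = \sum_x F x.
Proof.
rewrite (reindex enum_rank) /=; last by apply: onW_bij; exact: enum_rank_bij.
by apply: eq_bigr => x _; rewrite enum_rankK.
Qed.

Let sqN0 x : sq x != 0. Proof. by rewrite gt_eqF. Qed.

Let symS : S^T = S.
Proof.
apply/matrixP => i j; rewrite !mxE; set x := enum_val i; set y := enum_val j.
apply: (mulfI (sqN0 x)); apply: (mulfI (sqN0 y)).
transitivity (pi y * P y x).
  by rewrite -sqE; field; rewrite ?sqN0.
by rewrite -reversibleC -sqE; field; rewrite ?sqN0.
Qed.

Let vecS f : vec f *m S = vec (avg f).
Proof.
apply/rowP => j; rewrite !mxE.
rewrite /markov_op -(sum_enum (fun y => P (enum_val j) y * f y)) mulr_sumr.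
apply: eq_bigr => i _; rewrite !mxE.
set x := enum_val i; set y := enum_val j.
apply: (mulfI (sqN0 y)); transitivity (pi x * P x y * f x).
  by rewrite -sqE; field; rewrite ?sqN0.
by rewrite reversibleC -sqE; ring.
Qed.

Let vec_dot f g : (vec f *m (vec g)^T) 0 0 = dot f g.
Proof.
rewrite mxE /stat_dot -sum_enum; apply: eq_bigr => i _; rewrite !mxE -sqE.
by ring.
Qed.

Let vec_surj (u : 'rV[R]_#|T|) : exists f, u = vec f.
Proof.
exists (fun x => u 0 (enum_rank x) / sq x); apply/rowP => i.
by rewrite !mxE enum_valK mulrC divfK.
Qed.

Let vec_inj f g : vec f = vec g -> f = g.
Proof.
move=> /rowP fg; apply: funext => x; have := fg (enum_rank x).
by rewrite !mxE enum_rankK => /(mulfI (sqN0 x)).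
Qed.

Let charS : char_poly (trans_mx C) = char_poly S.
Proof.
apply: (@char_poly_conj _ _ _ _ (diag_mx (\row_i sq (enum_val i)))).
  rewrite unitmxE det_diag unitfE prodf_seq_neq0.
  by apply/allP => i _; rewrite mxE sqN0.
rewrite mul_diag_mx mul_mx_diag; apply/matrixP => i j; rewrite !mxE.
by rewrite divfK.
Qed.

Let v := vec (fun=> 1).

(** The default of [xget] is not reached: the characteristic polynomial of the symmetric matrix [S]
    splits over [R], and its roots can be sorted. *)
Let eigs_spec : sorted >=%R (eigenvalues (trans_mx C)) /\
  char_poly S = \prod_(a <- eigenvalues (trans_mx C)) ('X - a%:P).
Proof.
rewrite -charS.
pose Q := [set s : seq R | sorted >=%R s /\
   char_poly (trans_mx C) = \prod_(a <- s) ('X - a%:P)]%classic.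
have [d [U [_ charD _]]] := symmetric_unitary_diag symS.
pose s := sort >=%R [seq d 0 i | i : 'I_#|T|].
suff Qs : Q s by exact: (@xgetPex _ [::] Q (ex_intro _ s Qs)).
split; first by apply: sort_sorted => x y /=; exact: le_total.
rewrite charS charD; rewrite (perm_big [seq d 0 i | i : 'I_#|T|]) /=; last first.
  by rewrite perm_sort.
by rewrite big_map big_enum.
Qed.

Let Sv : v *m S = v. Proof. by rewrite /v vecS avg_const. Qed.

Let vN0 : v != 0.
Proof.
have /card_gt0P[x _] := ltnW (card_state_gt1 C).
apply/eqP => /rowP/(_ (enum_rank x)); rewrite !mxE mulr1 => /eqP.
by rewrite (negPf (sqN0 _)).
Qed.

Let simpleS (u : 'rV[R]_#|T|) : u *m S = u -> exists c, u = c *: v.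
Proof.
have [f ->] := vec_surj u; rewrite vecS => /vec_inj/avg_fixed_const cf.
have /card_gt0P[x _] := ltnW (card_state_gt1 C).
by exists (f x); apply/rowP => i; rewrite !mxE mulr1 mulrC (cf _ x).
Qed.

Let S_le1 (u : 'rV[R]_#|T|) : (u *m S *m u^T) 0 0 <= (u *m u^T) 0 0.
Proof. by have [f ->] := vec_surj u; rewrite vecS !vec_dot dot_avg_le. Qed.

Lemma lambda2_lt1 : lambda2 C < 1.
Proof.
have [so ch] := eigs_spec.
exact: (second_eigenvalue_lt1 symS (card_state_gt1 C) Sv vN0 simpleS S_le1 so ch).
Qed.

Lemma poincare_centered f : \sum_x pi x * f x = 0 ->
  dot (avg f) f <= lambda2 C * dot f f.
Proof.
move=> f0; have [so ch] := eigs_spec; rewrite -!vec_dot -vecS.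
apply: (second_eigenvalue_rayleigh symS (card_state_gt1 C) Sv vN0 simpleS S_le1 so ch).
by rewrite vec_dot -[RHS]f0; apply: eq_bigr => x _; rewrite mulr1.
Qed.

Lemma lambda2_eigenfunction : exists f,
  [/\ avg f = (fun x => lambda2 C * f x), exists x, f x != 0 & \sum_x pi x * f x = 0].
Proof.
have [so ch] := eigs_spec.
have [u uS uN0] := second_eigenvalue_eigenvector (card_state_gt1 C) ch.
move: uS uN0; have [f ->] := vec_surj u; rewrite vecS => Pf fN0; exists f.
have {}Pf : avg f = (fun x => lambda2 C * f x).
  apply: vec_inj; rewrite Pf; apply/rowP => i; rewrite !mxE /lambda2.
  by rewrite mulrCA.
split => //.
  apply/existsP; apply: contraNT fN0; rewrite negb_exists => /forallP H.
  apply/eqP/rowP => i; rewrite !mxE; have := H (enum_val i).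
  by rewrite negbK => /eqP ->; rewrite mulr0.
(* Invariance gives [pi(f) = lambda2 * pi(f)], and [lambda2 < 1] forces mean zero. *)
have := stat_avg f; rewrite Pf => /eqP.
under eq_bigr do rewrite mulrCA.
rewrite -mulr_sumr -subr_eq0 -{2}[\sum_x _]mul1r -mulrBl mulf_eq0 subr_eq0.
by rewrite (lt_eqF lambda2_lt1) /= => /eqP.
Qed.

Lemma lambda2_ge0 : 0 <= lambda2 C.
Proof.
have [f [Pf [x fx] _]] := lambda2_eigenfunction.
have : 0 <= dot (avg f) f := dot_avg_ge0 f.
have -> : dot (avg f) f = lambda2 C * dot f f.
  by rewrite Pf /stat_dot mulr_sumr; apply: eq_bigr => y _; ring.
rewrite pmulr_lge0// /stat_dot (bigD1 x) //= ltr_wpDr//.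
  by rewrite sumr_ge0// => y _; rewrite mulr_ge0 ?stat_ge0// -expr2 sqr_ge0.
by rewrite mulr_gt0 ?stat_gt0// -expr2 lt_neqAle sqr_ge0 andbT eq_sym sqrf_eq0.
Qed.

Lemma trel_ge1 : 1 <= trel C.
Proof.
have := lambda2_ge0; have := lambda2_lt1; rewrite /trel => l1 l0.
by rewrite invf_ge1 ?subr_gt0// gerBl.
Qed.

Lemma lambda2E : lambda2 C = 1 - (trel C)^-1.
Proof. by rewrite /trel invrK; ring. Qed.

Lemma poincare f : dot (avg f) f <=
  lambda2 C * dot f f + (1 - lambda2 C) * (\sum_x pi x * f x) ^+ 2.
Proof.
set m := \sum_x _; pose g x := f x - m.
have g0 : \sum_x pi x * g x = 0.
  rewrite /g; under eq_bigr do rewrite mulrBr.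
  by rewrite sumrB -mulr_suml stat_sum1 mul1r subrr.
have dm h : dot h (fun=> m) = (\sum_x pi x * h x) * m.
  by rewrite mulr_suml; apply: eq_bigr => x _; ring.
have := poincare_centered g0; rewrite /g avgB avg_const.
rewrite !dotBl !dotBr ![dot (fun=> m) _]dotC !dm stat_avg -/m.
have -> : \sum_x pi x * m = m by rewrite -mulr_suml stat_sum1 mul1r.
by lra.
Qed.

End Reversible.

(** * Comparison of mixing and hitting *)

Lemma expr_le_expR (R : realType) (x : R) t : 0 <= 1 - x ->
  (1 - x) ^+ t <= expR (- (x * t%:R)).
Proof.
move=> x1; rewrite -mulNr -[- x * _]mulrC expRM_natl lerXn2r ?nnegrE ?expR_ge0//.
exact: expR_ge1Dx.
Qed.

Lemma telescope_term_ge0 (R : realType) (a b : R) i r :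
  0 <= i.+1%:R / 2 * (a - b) ^+ 2 + (a ^+ 2 + b ^+ 2) / r%:R.
Proof.
rewrite addr_ge0//; first by rewrite mulr_ge0 ?sqr_ge0// divr_ge0.
by rewrite divr_ge0// addr_ge0 ?sqr_ge0.
Qed.

(** The bound does not depend on [k], so it controls the maximum over [[r, N]]. The AM-GM weight [r]
    is at most [i.+1] in the range of summation, and the terms with [i < k] are nonnegative. *)
Lemma sqr_le_telescope (R : realType) (a : nat -> R) r N k : (0 < r)%N ->
  (r <= k <= N)%N ->
  a k ^+ 2 <= a N ^+ 2 + \sum_(r <= i < N)
    (i.+1%:R / 2 * (a i - a i.+1) ^+ 2 + (a i ^+ 2 + a i.+1 ^+ 2) / r%:R).
Proof.
move=> r0 /andP[rk kN].
have rpos : 0 < r%:R :> R by rewrite ltr0n.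
rewrite (@big_cat_nat _ _ _ k) //= addrCA -[leLHS]add0r lerD//.
  by apply: sumr_ge0 => i _; exact: telescope_term_ge0.
have tel : \sum_(k <= i < N) (a i ^+ 2 - a i.+1 ^+ 2) = a k ^+ 2 - a N ^+ 2.
  rewrite -[RHS]opprB -(telescope_sumr (fun i => a i ^+ 2))// -sumrN.
  by apply: eq_bigr => i _; rewrite opprB.
rewrite -lerBlDl -tel [leLHS]big_nat [leRHS]big_nat.
apply: ler_sum => i /andP[ki _].
set D := a i - a i.+1; set b := a i.+1.
have -> : a i ^+ 2 - b ^+ 2 = D * (a i + b) by rewrite /D -/b; ring.
(* AM-GM: [2 D s <= r D^2 + s^2 / r] with [s = a i + b] *)
have amgm : D * (a i + b) <= r%:R / 2 * D ^+ 2 + (a i + b) ^+ 2 / r%:R / 2.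
  have -> : r%:R / 2 * D ^+ 2 + (a i + b) ^+ 2 / r%:R / 2 =
      D * (a i + b) + (r%:R * D - (a i + b)) ^+ 2 / r%:R / 2.
    by field; rewrite gt_eqF.
  by rewrite lerDl !divr_ge0// sqr_ge0.
apply: le_trans amgm _; apply: lerD.
  rewrite ler_wpM2r ?sqr_ge0// ler_wpM2r ?invr_ge0// ler_nat.
  by apply: leq_trans (leqnSn _); exact: leq_trans rk ki.
rewrite mulrAC ler_wpM2r ?invr_ge0// ler_pdivrMr//.
by have := sqr_ge0 (a i - b); lra.
Qed.

Section Comparison.
Variables (R : realType) (C : finite_chain R).
Hypotheses (lazyC : is_lazy C) (reversibleC : is_reversible C).
Hypothesis irreducibleC : is_irreducible C.
Local Notation T := (state C).
Local Notation pi := (@stat R C).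
Local Notation P := (@trans R C).
Local Notation avg := (@markov_op R C).
Local Notation dot := (@stat_dot R C).
Implicit Types (f g h : T -> R) (A B : {set T}) (x y z : T).

Let l0 : 0 <= lambda2 C. Proof. exact: lambda2_ge0. Qed.
Let l1 : lambda2 C < 1. Proof. exact: lambda2_lt1. Qed.
Let trel1 : 1 <= trel C. Proof. exact: trel_ge1. Qed.
Let trel0 : 0 < trel C. Proof. exact: lt_le_trans trel1. Qed.
Let symP : forall f g, dot (avg f) g = dot f (avg g).
Proof. exact: dot_avg_sym. Qed.

(** Each step uses [P^2 <= P] and then the Poincaré inequality, so the squared norm shrinks by
    [lambda2]. *)
Lemma dot_iter_avg_decay t g : \sum_x pi x * g x = 0 ->
  dot (iter t avg g) (iter t avg g) <= lambda2 C ^+ t * dot g g.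
Proof.
move=> g0; elim: t => [|t IH]; first by rewrite expr0 mul1r.
rewrite exprS -mulrA /=; apply: le_trans (ler_wpM2l l0 IH).
apply: le_trans (dot_avg2_le lazyC reversibleC _) _.
by apply: poincare_centered => //; rewrite stat_iter_avg.
Qed.

(* With [c_j = <P^j g, g>], the increments are [c_(2i) - 2 c_(2i+1) + c_(2i+2)];
   the second differences of [c] are nonnegative because P is, and summation
   by parts bounds their sum weighted by [j+1]. *)
Lemma sum_increments_le g n :
  \sum_(i < n) i.+1%:R * dot (fun x => iter i avg g x - iter i.+1 avg g x)
                             (fun x => iter i avg g x - iter i.+1 avg g x)
  <= dot g g.
Proof.
pose a i := iter i avg g.
(* The subtracted terms are the boundary terms of the summation by parts; keeping them makes the
   induction close. *)
suff : \sum_(i < n) i.+1%:R * dot (fun x => a i x - a i.+1 x) (fun x => a i x - a i.+1 x)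
    <= dot g g - dot (a n) (a n) - 2 * n%:R * (dot (a n) (a n) - dot (avg (a n)) (a n)).
  move=> /le_trans; apply; rewrite -addrA -opprD gerBl addr_ge0 ?dot_ge0//.
  by rewrite mulr_ge0 ?mulr_ge0 ?ler0n// subr_ge0 dot_avg_le.
elim: n => [|n IH]; first by rewrite big_ord0 subrr mulr0 mul0r subr0.
rewrite big_ord_recr /=; apply: le_trans (lerD IH (lexx _)) _.
set h := a n.
have := dot_ge0 (fun x => h x - avg h x).
have := dot_avg_ge0 lazyC reversibleC (fun x => h x - avg h x).
rewrite avgB !dotBl !dotBr !symP => e1 e0.
have n0 : 0 <= n%:R :> R by rewrite ler0n.
have := mulr_ge0 n0 e0; have := mulr_ge0 n0 e1.
by rewrite -[n.+1]addn1 natrD; lra.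
Qed.

(** The right-hand side of [sqr_le_telescope] along [P^i g (x)]: it dominates [(P^k g (x))^2] for
    all [r <= k <= N] at once. *)
Definition maximal_bound g r N x : R :=
  iter N avg g x ^+ 2 + \sum_(r <= i < N)
    (i.+1%:R / 2 * (iter i avg g x - iter i.+1 avg g x) ^+ 2 +
     (iter i avg g x ^+ 2 + iter i.+1 avg g x ^+ 2) / r%:R).

Lemma maximal_bound_ge0 g r N x : 0 <= maximal_bound g r N x.
Proof.
rewrite addr_ge0 ?sqr_ge0// sumr_ge0// => i _; exact: telescope_term_ge0.
Qed.

Lemma sum_lambda2_le n : \sum_(i < n) lambda2 C ^+ i <= trel C.
Proof.
rewrite -[leRHS]div1r ler_pdivlMr ?subr_gt0//.
have := subrX1 (lambda2 C) n; set s := \sum_(i < n) _ => E.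
by have := exprn_ge0 n l0; lra.
Qed.

(** With [G = |g|^2], the final term costs [G], the weighted increments [G / 2], and the remaining
    geometric sum [2 G trel / r <= 2 G]. *)
Lemma stat_maximal_bound g r N : (0 < r)%N -> trel C <= r%:R ->
  \sum_x pi x * g x = 0 ->
  \sum_x pi x * maximal_bound g r N x <= 4 * dot g g.
Proof.
move=> r0 rr g0; have rpos : 0 < r%:R :> R by rewrite ltr0n.
pose a i := iter i avg g.
have dE f : \sum_x pi x * f x ^+ 2 = dot f f by apply: eq_bigr => x _; rewrite expr2.
have -> : \sum_x pi x * maximal_bound g r N x = dot (a N) (a N) +
    \sum_(r <= i < N) (i.+1%:R / 2 * dot (fun x => a i x - a i.+1 x) (fun x => a i x - a i.+1 x)
      + (dot (a i) (a i) + dot (a i.+1) (a i.+1)) / r%:R).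
  rewrite /maximal_bound; under eq_bigr do rewrite mulrDr.
  rewrite big_split /= dE; congr (_ + _).
  under eq_bigr do rewrite mulr_sumr.
  rewrite exchange_big /=; apply: eq_bigr => i _.
  rewrite -!dE mulrDl mulr_sumr !mulr_suml -!big_split /=.
  by apply: eq_bigr => x _; rewrite /a; ring.
set G := dot g g; have G0 : 0 <= G by exact: dot_ge0.
have aG i : dot (a i) (a i) <= lambda2 C ^+ i * G by exact: dot_iter_avg_decay.
have aG' i : dot (a i.+1) (a i.+1) <= lambda2 C ^+ i * G.
  apply: le_trans (aG _) _; rewrite ler_wpM2r// exprS ler_piMl ?exprn_ge0//.
  exact: ltW.
have S0 (F : nat -> R) : (forall i, 0 <= F i) ->
    \sum_(r <= i < N) F i <= \sum_(i < N) F i.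
  move=> F0; rewrite -(big_mkord predT F).
  have [rN|/ltnW Nr] := leqP r N; last by rewrite [leLHS]big_geq//; apply: sumr_ge0.
  by rewrite [leRHS](@big_cat_nat _ _ _ r) //= lerDr sumr_ge0.
rewrite big_split /=.
have H1 : dot (a N) (a N) <= G.
  apply: le_trans (aG N) _; rewrite ler_piMl// exprn_ile1//; exact: ltW.
have H2 : \sum_(r <= i < N) i.+1%:R / 2 *
    dot (fun x => a i x - a i.+1 x) (fun x => a i x - a i.+1 x) <= G / 2.
  apply: le_trans (S0 _ _) _.
    by move=> i; rewrite mulr_ge0 ?divr_ge0 ?ler0n// dot_ge0.
  under eq_bigr do rewrite mulrAC.
  by rewrite -mulr_suml ler_pM2r ?invr_gt0//; exact: sum_increments_le.
have H3 : \sum_(r <= i < N) (dot (a i) (a i) + dot (a i.+1) (a i.+1)) / r%:R <= 2 * G.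
  apply: le_trans (S0 _ _) _.
    by move=> i; rewrite divr_ge0 ?ler0n// addr_ge0 ?dot_ge0.
  apply: (@le_trans _ _ (\sum_(i < N) lambda2 C ^+ i * (2 * G / r%:R))).
    apply: ler_sum => i _; rewrite mulrA ler_wpM2r ?invr_ge0 ?ler0n//.
    by have := aG i; have := aG' i; lra.
  rewrite -mulr_suml; apply: le_trans (ler_wpM2r _ (sum_lambda2_le N)) _.
    by rewrite divr_ge0 ?mulr_ge0.
  by rewrite mulrA ler_pdivrMr// mulrC ler_wpM2l ?mulr_ge0.
by lra.
Qed.

(** For the set [A] realizing the distance, a set [G] of mass at least [alpha] is found from which
    [A] is charged almost fully at all times in [[2r, t + 2r]]; then decompose at the hitting time
    of [G]. The factor 4 comes from the maximal inequality. *)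
Lemma dist_le_hit_prob (alpha eta : R) t r : 0 < eta -> (0 < r)%N -> trel C <= r%:R ->
  4 * expR (- (r%:R / trel C)) <= eta ^+ 2 * (1 - alpha) ->
  dist C (t + (r + r)) <= hit_prob C alpha t + eta.
Proof.
move=> eta0 r0 rr small.
have ne0 : 0 <= hit_prob C alpha t + eta.
  by rewrite addr_ge0 ?hit_prob_ge0// ltW.
apply: dist_le => // x.
rewrite tv_eq_sum_diff ?trans_pow_sum1 ?stat_sum1//; set A := [set _ | _].
rewrite sumrB -/(stat_set A) -iter_avg_indicator.
set ind := fun y => (y \in A)%:R; set p := stat_set A.
have p0 : 0 <= p := stat_set_ge0 A; have p1 : p <= 1 := stat_set_le1 A.
have ind0 y : 0 <= ind y by rewrite ler0n.
have iter_ge0 k y : 0 <= iter k avg ind y.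
  by elim: k y => // k IH y; exact: avg_ge0.
(* When [pi(A) <= eta] the bound is immediate; otherwise [p - eta] is nonnegative, as the
   decomposition at [G] requires. *)
have [pe|/ltW ep] := leP p eta.
  apply: le_trans (_ : eta <= _); last by rewrite lerDr hit_prob_ge0.
  by apply: le_trans pe; rewrite gerBl.
(* The first [r] steps make the centered indicator small in L^2; the next [r] steps reach the window
   of the maximal inequality. *)
pose g0 y := ind y - p; pose g := iter r avg g0.
have iter_g0 k : iter k avg g0 = (fun y => iter k avg ind y - p).
  by elim: k => // k IH /=; rewrite IH avgB avg_const.
have mean0 : \sum_y pi y * g0 y = 0.
  rewrite /g0; under eq_bigr do rewrite mulrBr.
  rewrite sumrB -mulr_suml stat_sum1 mul1r /p /stat_set [X in _ - X]big_mkcond.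
  by rewrite -sumrB big1// => y _; rewrite /ind; case: (y \in A); rewrite ?mulr1 ?mulr0 subrr.
have g0_le1 : dot g0 g0 <= 1.
  rewrite -[leRHS](stat_sum1 C); apply: ler_sum => y _.
  rewrite ler_piMr ?stat_ge0// /g0 /ind; case: (y \in A) => /=; nra.
have g_small : dot g g <= expR (- (r%:R / trel C)).
  apply: le_trans (dot_iter_avg_decay r mean0) _.
  apply: le_trans (ler_wpM2l (exprn_ge0 r l0) g0_le1) _.
  rewrite mulr1 lambda2E mulrC; apply: expr_le_expR.
  by rewrite -lambda2E.
pose G := [set y | maximal_bound g r (t + r) y <= eta ^+ 2].
have piG : alpha <= stat_set G.
  apply: le_trans (stat_set_markov (f := maximal_bound g r (t + r)) _ _); first last.
  - exact: maximal_bound_ge0.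
  - by rewrite exprn_gt0.
  rewrite lerBrDr -lerBrDl ler_pdivrMr ?exprn_gt0// [leRHS]mulrC.
  apply: le_trans small; apply: le_trans (stat_maximal_bound (t + r) r0 rr _) _.
    by rewrite stat_iter_avg.
  by rewrite ler_wpM2l.
have onG y k : y \in G -> (r + r <= k <= t + (r + r))%N -> p - eta <= iter k avg ind y.
  rewrite inE => yG /andP[k1 k2].
  have krE : k = (k - r + r)%N by rewrite subnK// (leq_trans _ k1) ?leq_addr.
  have : iter (k - r) avg g y ^+ 2 <= eta ^+ 2.
    apply: le_trans yG; apply: (sqr_le_telescope (fun i => iter i avg g y)) => //.
    have rk : (r <= k)%N by exact: leq_trans (leq_addr r r) k1.
    by rewrite leq_subRL// k1 leq_subLR addnCA.
  rewrite /g -iterD -krE iter_g0; set X := _ - p => Xe.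
  suff : - eta <= X by rewrite /X; lra.
  by rewrite leNgt; apply/negP => lt; nra.
have := @iter_avg_through _ _ G ind (p - eta) (r + r) (t + (r + r)) x t _ ind0 onG (leqnn _).
rewrite subr_ge0 => /(_ ep) through.
have := hit_tail_le_prob t x piG; have := hit_tail_le1 x G t.
have := hit_tail_ge0 x G t; set q := hit_tail x G t in through * => q0 q1 qp.
(* [p - (p - eta)(1 - q) = eta + q (p - eta) <= eta + q]. *)
have : 0 <= q * (1 - (p - eta)) by rewrite mulr_ge0// lerBrDr; lra.
by lra.
Qed.

(** The survival function is multiplied by [P] and cut off outside [A] at each step. As it vanishes
    on [A], Cauchy-Schwarz bounds its squared mean by [pi(A^c)] times its squared norm, and the
    Poincaré inequality gives the factor [1 - pi(A) / trel]. *)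
Lemma dot_hit_tail_decay A (alpha : R) s : 0 <= alpha -> alpha <= stat_set A ->
  dot (fun x => hit_tail x A s) (fun x => hit_tail x A s) <=
    expR (- (alpha * s%:R / trel C)).
Proof.
move=> a0 aA; have a1 : alpha <= 1 := le_trans aA (stat_set_le1 A).
pose u s x := hit_tail x A s; rewrite -/(u s).
have gap0 : 0 < (trel C)^-1 by rewrite invr_gt0.
have gap1 : (trel C)^-1 <= 1 by rewrite invf_le1.
suff : dot (u s) (u s) <= (1 - alpha / trel C) ^+ s.
  move=> /le_trans; apply; rewrite mulrAC; apply: expr_le_expR.
  by rewrite subr_ge0 mulr_ile1// ltW.
elim: s => [|s IH].
  rewrite expr0 -[leRHS](stat_sum1 C); apply: ler_sum => x _.
  by rewrite ler_piMr ?stat_ge0// mulr_ile1 ?hit_tail_ge0 ?hit_tail_le1.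
set m := \sum_x pi x * u s x.
have m0 : 0 <= m.
  by apply: sumr_ge0 => x _; rewrite mulr_ge0 ?stat_ge0 ?hit_tail_ge0.
set q := 1 - stat_set A; have q0 : 0 <= q by rewrite subr_ge0 stat_set_le1.
have mE : m = \sum_(x in ~: A) pi x * u s x.
  rewrite [RHS]big_mkcond; apply: eq_bigr => x _; rewrite inE.
  by case: ifPn => //; rewrite negbK => xA; rewrite /u hit_tail_in// mulr0.
have dE : dot (u s) (u s) = \sum_(x in ~: A) pi x * (u s x * u s x).
  rewrite [RHS]big_mkcond; apply: eq_bigr => x _; rewrite inE.
  by case: ifPn => //; rewrite negbK => xA; rewrite /u hit_tail_in// !mulr0.
(* Cauchy-Schwarz on the complement of [A], by expanding the square of [q u - m]; this divides by
   [q], hence the separate case of a null complement. *)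
have cs : m ^+ 2 <= q * dot (u s) (u s).
  have [qp|q_le0] := ltP 0 q; last first.
    have -> : m = 0.
      apply/le_anti; rewrite m0 andbT; apply: le_trans q_le0.
      rewrite /q -stat_setC mE; apply: ler_sum => x _.
      by rewrite ler_piMr ?stat_ge0 ?hit_tail_le1.
    by rewrite expr0n mulr_ge0 ?dot_ge0.
  have : 0 <= \sum_(x in ~: A) pi x * (q * u s x - m) ^+ 2.
    by apply: sumr_ge0 => x _; rewrite mulr_ge0 ?stat_ge0 ?sqr_ge0.
  have -> : \sum_(x in ~: A) pi x * (q * u s x - m) ^+ 2 =
      q * (q * dot (u s) (u s) - m ^+ 2).
    have expand (c d : R) : \sum_(x in ~: A) pi x * (c * u s x - d) ^+ 2 =
        c ^+ 2 * dot (u s) (u s) - 2 * c * d * m + d ^+ 2 * q.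
      rewrite dE mE /q -stat_setC /stat_set !mulr_sumr -sumrB -big_split /=.
      by apply: eq_bigr => x _; ring.
    by rewrite expand; ring.
  by rewrite pmulr_rge0// subr_ge0.
apply: (@le_trans _ _ ((1 - alpha / trel C) * dot (u s) (u s))); last first.
  by rewrite exprS ler_wpM2l// subr_ge0 mulr_ile1// ltW.
apply: (@le_trans _ _ (dot (avg (u s)) (avg (u s)))).
  apply: ler_sum => x _; rewrite ler_wpM2l ?stat_ge0// /u hit_tailS.
  have := avg_ge0 x (fun y => hit_tail_ge0 y A s).
  by case: (x \notin A) => h; rewrite ?mul1r// !mul0r mulr_ge0.
apply: le_trans (dot_avg2_le lazyC reversibleC _) _.
apply: le_trans (poincare reversibleC irreducibleC _) _; rewrite -/m.
rewrite lambda2E; set gm := (trel C)^-1 in gap0 gap1 *.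
have := ler_wpM2l (ltW gap0) cs.
have : 0 <= gm * ((stat_set A - alpha) * dot (u s) (u s)).
  by rewrite mulr_ge0 ?(ltW gap0)// mulr_ge0 ?dot_ge0// subr_ge0.
rewrite /q; lra.
Qed.

(** By L^2 decay and Markov's inequality, the states from which [A] is missed for [s] steps with
    probability at most [delta] form a set of mass at least [beta]; hit that set first. *)
Lemma hit_prob_change_level (alpha beta delta : R) t s : 0 <= alpha -> 0 < delta ->
  expR (- (alpha * s%:R / trel C)) <= delta ^+ 2 * (1 - beta) ->
  hit_prob C alpha (t + s) <= hit_prob C beta t + delta.
Proof.
move=> a0 d0 small; apply: hit_prob_le => [|x A aA].
  by rewrite addr_ge0 ?hit_prob_ge0// ltW.
pose B := [set y | hit_tail y A s ^+ 2 <= delta ^+ 2].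
have piB : beta <= stat_set B.
  apply: le_trans (stat_set_markov (f := fun y => hit_tail y A s ^+ 2) _ _); first last.
  - by move=> y; exact: sqr_ge0.
  - by rewrite exprn_gt0.
  rewrite lerBrDr -lerBrDl ler_pdivrMr ?exprn_gt0// [leRHS]mulrC.
  exact: le_trans (dot_hit_tail_decay s a0 aA) small.
apply: le_trans (hit_tail_through (B := B) (delta := delta) x t _ _) _.
- move=> y; rewrite inE.
  by rewrite ler_sqr ?nnegrE ?hit_tail_ge0// ltW.
- exact: ltW.
- by rewrite lerD2r hit_tail_le_prob.
Qed.

(** * Lower bounds on distance and survival *)

Lemma exists_stat_le_half : exists x, pi x <= 1 / 2.
Proof.
have /card_gt1P[x [y [_ _ xy]]] := card_state_gt1 C.
have : pi x + pi y <= 1.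
  rewrite -(stat_sum1 C) (bigD1 x) //= lerD2l (bigD1 y) 1?eq_sym//= lerDl.
  by rewrite sumr_ge0// => z _; exact: stat_ge0.
by have [xh|xh] := leP (pi x) (1 / 2); [exists x|exists y; lra].
Qed.

(** The target is the complement of a single state of mass at most 1/2, which the lazy chain leaves
    slowly. *)
Lemma hit_prob_ge_lazy (alpha : R) t : alpha <= 1 / 2 ->
  (1 / 2) ^+ t <= hit_prob C alpha t.
Proof.
move=> ah; have [x xh] := exists_stat_le_half.
have xA : x \notin ~: [set x] by rewrite !inE eqxx.
apply: le_trans (hit_tail_lazy t lazyC xA) _; apply: hit_tail_le_prob.
by rewrite stat_setC /stat_set big_set1; lra.
Qed.

(* On the complement of A := {f <= 0}, the eigenfunction f bounds the survival
   probability from below. *)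
Lemma hit_prob_ge_lambda2 (alpha : R) t : alpha <= 1 / 2 ->
  lambda2 C ^+ t <= hit_prob C alpha t.
Proof.
move=> ah; have [f [Pf fN0 f0]] :=
  lambda2_eigenfunction reversibleC irreducibleC.
(* One of [{f <= 0}] and [{f >= 0}] has mass at least 1/2; pass to [-f] in the second case. *)
wlog piA : f Pf fN0 f0 / 1 / 2 <= stat_set [set x | f x <= 0].
  move=> wl; have [h|h] := leP (1 / 2) (stat_set [set x | f x <= 0]).
    exact: (wl f).
  apply: (wl (fun x => - f x)).
  - have -> : (fun x => - f x) = (fun x => (fun=> 0) x - f x).
      by apply: funext => x; rewrite sub0r.
    by rewrite avgB avg_const Pf; apply: funext => x; rewrite !sub0r mulrN.
  - by have [x fx] := fN0; exists x; rewrite oppr_eq0.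
  - by under eq_bigr do rewrite mulrN; rewrite sumrN f0 oppr0.
  have : stat_set (~: [set x | f x <= 0]) <= stat_set [set x | - f x <= 0].
    rewrite /stat_set big_mkcond [leRHS]big_mkcond; apply: ler_sum => x _.
    rewrite !inE oppr_le0 -ltNge; case: (ltP 0 (f x)) => [/ltW -> //|_].
    by case: ifP; rewrite ?stat_ge0.
  by rewrite stat_setC; lra.
have [x0 fx0] : exists x, 0 < f x.
  apply/existsP; apply: contraT; rewrite negb_exists => /forallP H.
  have [x /negP[]] := fN0; move/eqP: f0.
  rewrite -oppr_eq0 -sumrN psumr_eq0 => [/allP/(_ x (mem_index_enum _))|y _].
    by rewrite /= oppr_eq0 mulf_eq0 (gt_eqF (stat_gt0 irreducibleC x)).
  by rewrite -mulrN mulr_ge0 ?stat_ge0// oppr_ge0 leNgt.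
have [x _ xmax] := @arg_maxP _ _ T x0 predT f isT.
have fx : 0 < f x by apply: lt_le_trans fx0 _; exact: xmax.
set A := [set x | f x <= 0] in piA.
suff surv y s : lambda2 C ^+ s * f y <= f x * hit_tail y A s.
  apply: le_trans (hit_tail_le_prob t x (le_trans ah piA)).
  by rewrite -(ler_pM2l fx) mulrC surv.
elim: s y => [|s IH] y.
  rewrite hit_tail0 expr0 mul1r inE; case: (leP (f y) 0) => h /=.
    by rewrite mulr0.
  by rewrite mulr1; exact: xmax.
have [yA|yA] := boolP (y \in A).
  rewrite hit_tail_in// mulr0; move: yA; rewrite inE => yA.
  by rewrite mulr_ge0_le0// exprn_ge0.
rewrite hit_tail_notin// exprS -mulrA mulrCA.
have -> : lambda2 C * f y = avg f y by rewrite Pf.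
rewrite /markov_op !mulr_sumr; apply: ler_sum => z _.
by rewrite mulrCA [leRHS]mulrCA ler_wpM2l ?trans_ge0.
Qed.

(** Test [P^t(x, .) - pi] against the eigenfunction, which has mean zero, at a state [x] maximizing
    [|f|]. *)
Lemma dist_ge_lambda2 t : lambda2 C ^+ t / 2 <= dist C t.
Proof.
have [f [Pf [x0 fx0] f0]] := lambda2_eigenfunction reversibleC irreducibleC.
have [x _ xmax] := @arg_maxP _ _ T x0 predT (fun x => `|f x|) isT.
have fx : 0 < `|f x|.
  by apply: lt_le_trans (xmax x0 isT); rewrite normr_gt0.
apply: le_trans (tv_le_dist t x); rewrite /tv div1r [leRHS]mulrC ler_pM2r ?invr_gt0//.
rewrite -(ler_pM2r fx).
have -> : lambda2 C ^+ t * `|f x| = `|\sum_y (trans_pow t x y - pi y) * f y|.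
  under eq_bigr do rewrite mulrBl.
  rewrite sumrB f0 subr0 -iter_avgE -[LHS]ger0_norm ?mulr_ge0 ?exprn_ge0//.
  rewrite normrM normr_id -normrM; congr `|_|.
  suff : forall y, iter t avg f y = lambda2 C ^+ t * f y by [].
  elim: t => [|t IH] y; first by rewrite expr0 mul1r.
  rewrite iterS; have -> : iter t avg f = (fun y => lambda2 C ^+ t * f y) by exact: funext.
  rewrite exprS mulrC mulrA [f y * _]mulrC -[lambda2 C * _]/((fun x => lambda2 C * f x) y).
  rewrite -Pf /markov_op mulr_suml.
  by apply: eq_bigr => z _; ring.
apply: le_trans (ler_norm_sum _ _ _) _; rewrite mulr_suml; apply: ler_sum => y _.
by rewrite normrM ler_wpM2l//; exact: xmax.
Qed.

(** For [0 < g <= 1/2], [1 / (1 - g) <= 1 + 2 g <= exp (2 g)]. *)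
Lemma lambda2_ge_expR : 1 / 2 <= lambda2 C -> expR (- (2 / trel C)) <= lambda2 C.
Proof.
rewrite lambda2E; set g := (trel C)^-1 => lh.
have gp : 0 < g by rewrite invr_gt0.
have gl : 0 < 1 - g by lra.
rewrite expRN -[leRHS]invrK lef_pV2 ?posrE ?expR_gt0 ?invr_gt0//.
apply: le_trans (expR_ge1Dx _).
by rewrite -div1r ler_pdivrMr//; nra.
Qed.

(** When [lambda2 < 1/2], [trel < 2] and laziness takes over:
    [exp (- 2 / trel) <= exp (-1) <= 1/2]. *)
Lemma hit_prob_ge_expR (alpha : R) t : alpha <= 1 / 2 ->
  expR (- (2 * t%:R / trel C)) <= hit_prob C alpha t.
Proof.
move=> ah; have -> : - (2 * t%:R / trel C) = t%:R * - (2 / trel C) by ring.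
rewrite expRM_natl; have [lh|lh] := leP (1 / 2) (lambda2 C).
  apply: le_trans (hit_prob_ge_lambda2 t ah).
  by rewrite lerXn2r ?nnegrE ?expR_ge0// lambda2_ge_expR.
apply: le_trans (hit_prob_ge_lazy t ah); rewrite lerXn2r ?nnegrE ?expR_ge0 ?divr_ge0//.
apply: (@le_trans _ _ (expR (-1))).
  rewrite ler_expR lerN2 ler_pdivlMr// mul1r.
  have : (trel C)^-1 > 2^-1 by move: lh; rewrite lambda2E; lra.
  by rewrite ltf_pV2 ?posrE// => /ltW.
rewrite expRN div1r lef_pV2 ?posrE ?expR_gt0//.
by have := @expR_ge1Dx R 1; lra.
Qed.

Lemma dist_ge_expR t : 1 / 2 <= lambda2 C ->
  expR (- (2 * t%:R / trel C)) / 2 <= dist C t.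
Proof.
move=> lh; apply: le_trans (dist_ge_lambda2 t); rewrite ler_pM2r ?invr_gt0//.
have -> : - (2 * t%:R / trel C) = t%:R * - (2 / trel C) by ring.
by rewrite expRM_natl lerXn2r ?nnegrE ?expR_ge0// lambda2_ge_expR.
Qed.

(** Laziness gives [pi(x) >= P^t(x, x) - d(t) >= 2 e - e] for every [x], while the distance at time
    0 is the maximum of [1 - pi(x)]. *)
Lemma dist0_le (e : R) t : dist C t <= e -> 2 * e <= (1 / 2) ^+ t -> dist C 0 <= 1 - e.
Proof.
move=> de small.
have piC x : e <= pi x.
  have : \sum_(y in ~: [set x]) (pi y - trans_pow t x y) <= tv (trans_pow t x) pi.
    by apply: sum_diff_le_tv; rewrite trans_pow_sum1 stat_sum1.
  have tvd := tv_le_dist t x.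
  have E : \sum_(y in ~: [set x]) trans_pow t x y = 1 - trans_pow t x x.
    rewrite -(trans_pow_sum1 t x) [X in _ = X - _](bigD1 x) //= addrAC subrr add0r.
    by apply: eq_bigl => y; rewrite !inE.
  rewrite sumrB E -/(stat_set _) stat_setC /stat_set big_set1.
  by have := lazy_trans_pow t x lazyC; lra.
have /card_gt0P[x0 _] := ltnW (card_state_gt1 C).
have pi1 x : pi x <= 1.
  by have := stat_set_le1 [set x]; rewrite /stat_set big_set1.
apply: dist_le => [|x]; first by rewrite subr_ge0 (le_trans (piC x0)).
suff -> : tv (trans_pow 0 x) pi = 1 - pi x by rewrite lerB.
rewrite /tv (bigD1 x) //= trans_pow0 eqxx ger0_norm ?subr_ge0//.
have -> : \sum_(y | y != x) `|trans_pow 0 x y - pi y| = 1 - pi x.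
  rewrite -(stat_sum1 C) [X in _ = X - _](bigD1 x) //= addrAC subrr add0r.
  apply: eq_bigr => y yx; rewrite trans_pow0 eq_sym (negPf yx) sub0r normrN.
  by rewrite ger0_norm ?stat_ge0.
by have -> : true%:R = 1 :> R by []; field.
Qed.

Lemma dist0_ge : 1 / 2 <= dist C 0.
Proof.
have [x xh] := exists_stat_le_half.
apply: le_trans (tv_le_dist 0 x).
have : \sum_(y in ~: [set x]) (pi y - trans_pow 0 x y) <= tv (trans_pow 0 x) pi.
  by apply: sum_diff_le_tv; rewrite trans_pow_sum1 stat_sum1.
apply: le_trans; rewrite (eq_bigr pi) => [|z]; last first.
  by rewrite !inE eq_sym trans_pow0 => /negPf ->; rewrite subr0.
by rewrite -/(stat_set _) stat_setC /stat_set big_set1; lra.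
Qed.

(** For [beta] this close to 1, only the whole space has mass at least [beta], and it is hit at time
    0. Comparison with this level makes all mixing and hitting times finite. *)
Lemma hit_prob0_eq0 : exists2 beta : R, 0 < beta < 1 & hit_prob C beta 0 = 0.
Proof.
have /card_gt1P[x0 [_ [_ _ _]]] := card_state_gt1 C.
have [x _ xmin] := @arg_minP _ _ T x0 predT pi isT.
have px := stat_gt0 irreducibleC x.
have pi1 : pi x <= 1 by have := stat_set_le1 [set x]; rewrite /stat_set big_set1.
exists (1 - pi x / 2); first by apply/andP; split; lra.
apply/le_anti; rewrite hit_prob_ge0 andbT; apply: hit_prob_le => // y A pA.
rewrite hit_tail0; case: (boolP (y \in A)) => // yA.
have : stat_set A <= stat_set (~: [set y]).
  rewrite /stat_set big_mkcond [leRHS]big_mkcond; apply: ler_sum => z _.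
  rewrite !inE; case: eqP => [->|_ /=]; first by rewrite (negPf yA).
  by case: ifP; rewrite ?stat_ge0.
rewrite stat_setC /stat_set big_set1 -/(stat_set A) => h.
by have := xmin y isT; lra.
Qed.

End Comparison.

(** * Mixing and hitting times of one chain *)

Lemma min_timeP (Q : pred nat) : (exists t, Q t) ->
  Q (min_time Q) /\ forall t, Q t -> (min_time Q <= t)%N.
Proof.
by rewrite /min_time; case: pselect => // exQ _; case: ex_minnP => t Qt minQ.
Qed.

Lemma expRN_small (R : realType) (c : R) : 0 < c ->
  exists2 K : R, 1 <= K & forall y, K <= y -> expR (- y) <= c.
Proof.
move=> c0; exists (Num.max 1 (- ln c)); first by rewrite le_max lexx.
move=> y; rewrite ge_max => /andP[_ h].
by rewrite -[leRHS](lnK c0) ler_expR lerNl.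
Qed.

Lemma nat_ceil (R : realType) (x : R) : 0 <= x ->
  exists2 r : nat, (0 < r)%N & x <= r%:R <= x + 1.
Proof.
move=> x0; exists (Num.truncn x).+1 => //.
have /andP[h1 h2] := truncn_itv x0.
by rewrite (ltW h2) /= -natr1 lerD2r.
Qed.

Definition regular_chain (R : realType) (C : finite_chain R) :=
  [/\ is_lazy C, is_reversible C & is_irreducible C].

Section Times.
Variables (R : realType) (C : finite_chain R).
Hypothesis regC : regular_chain C.

Let lazyC : is_lazy C. Proof. by case: regC. Qed.
Let revC : is_reversible C. Proof. by case: regC. Qed.
Let irrC : is_irreducible C. Proof. by case: regC. Qed.
Let trel1 : 1 <= trel C. Proof. exact: trel_ge1. Qed.
Let trel0 : 0 < trel C. Proof. exact: lt_le_trans trel1. Qed.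

Lemma dist_small (e : R) : 0 < e -> exists t, dist C t <= e.
Proof.
move=> e0; have [beta /andP[b0 b1] hb] := hit_prob0_eq0 irrC.
have c0 : 0 < e ^+ 2 * (1 - beta) / 4.
  by rewrite divr_gt0// mulr_gt0 ?exprn_gt0// subr_gt0.
have [K K1 HK] := expRN_small c0.
have K0 : 0 <= K by exact: le_trans K1.
have [r r0 /andP[Kr _]] := nat_ceil (mulr_ge0 K0 (ltW trel0)).
exists (0 + (r + r))%N; rewrite -[leRHS]add0r -hb.
apply: dist_le_hit_prob => //.
  by apply: le_trans Kr; rewrite ler_peMl// ltW.
by rewrite mulrC -ler_pdivlMr// HK// ler_pdivlMr.
Qed.

Lemma hit_prob_small (alpha e : R) : 0 < alpha -> 0 < e ->
  exists t, hit_prob C alpha t <= e.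
Proof.
move=> a0 e0; have [beta /andP[b0 b1] hb] := hit_prob0_eq0 irrC.
have c0 : 0 < e ^+ 2 * (1 - beta).
  by rewrite mulr_gt0 ?exprn_gt0// subr_gt0.
have [K K1 HK] := expRN_small c0.
have K0 : 0 <= K / alpha by rewrite divr_ge0 ?(le_trans _ K1)// ltW.
have [r r0 /andP[Kr _]] := nat_ceil (mulr_ge0 K0 (ltW trel0)).
exists (0 + r)%N; rewrite -[leRHS]add0r -hb.
apply: hit_prob_change_level => //; first exact: ltW.
by apply: HK; rewrite ler_pdivlMr// -ler_pdivrMl// mulrA [_^-1 * _]mulrC.
Qed.

Lemma tmixP (e : R) : 0 < e ->
  dist C (tmix C e) <= e /\ forall t, dist C t <= e -> (tmix C e <= t)%N.
Proof. by move=> e0; apply: (@min_timeP (fun t => dist C t <= e)); exact: dist_small. Qed.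

Lemma hitP (alpha e : R) : 0 < alpha -> 0 < e ->
  hit_prob C alpha (hit C alpha e) <= e /\
  forall t, hit_prob C alpha t <= e -> (hit C alpha e <= t)%N.
Proof.
move=> a0 e0; apply: (@min_timeP (fun t => hit_prob C alpha t <= e)).
exact: hit_prob_small.
Qed.

Lemma tmix_anti (e e' : R) : 0 < e -> e <= e' -> (tmix C e' <= tmix C e)%N.
Proof.
move=> e0 ee'; have [_ mn] := tmixP (lt_le_trans e0 ee').
by apply: mn; have [h _] := tmixP e0; exact: le_trans h ee'.
Qed.

Lemma hit_anti (alpha beta e e' : R) : 0 < alpha -> alpha <= beta ->
  0 < e -> e <= e' -> (hit C beta e' <= hit C alpha e)%N.
Proof.
move=> a0 ab e0 ee'; have [_ mn] := hitP (lt_le_trans a0 ab) (lt_le_trans e0 ee').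
apply: mn; have [h _] := hitP a0 e0; apply: le_trans ee'.
by apply: le_trans h; exact: hit_prob_anti.
Qed.

Lemma tmix_gt0 (e : R) : 0 < e -> e < 1 / 2 -> (0 < tmix C e)%N.
Proof.
move=> e0 e1; rewrite lt0n; apply/eqP => t0; have [] := tmixP e0.
by rewrite t0 => h _; have := dist0_ge C; lra.
Qed.

Lemma hit_le_tmix (e theta : R) : 0 < e -> e < 1 -> 0 < theta ->
  (hit C (1 - e) (theta + e) <= tmix C theta)%N.
Proof.
move=> e0 e1 th0; have e1' : 0 < 1 - e by rewrite subr_gt0.
have [_ mn] := hitP e1' (addr_gt0 th0 e0).
apply: mn; have [h _] := tmixP th0.
by apply: le_trans (hit_prob_le_dist _ _ (ltW e0)) _; rewrite lerD2r.
Qed.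

(** Otherwise [d(0) <= 1 - e], so [tmix(1 - e)] and with it [tmix(e)] would be 0, although
    [d(0) >= 1/2 > e]. *)
Lemma tmix_eq_large (e : R) : 0 < e -> e < 1 / 2 ->
  (tmix C e <= tmix C (1 - e))%N -> (1 / 2) ^+ tmix C e < 2 * e.
Proof.
move=> e0 e1 le; have e1' : 0 < 1 - e by lra.
rewrite ltNge; apply/negP => small.
have [h _] := tmixP e0; have := dist0_le lazyC h small => d0.
have [_ mn] := tmixP e1'.
have := leq_trans le (mn _ d0); rewrite leqn0 => /eqP t0.
by have := tmix_gt0 e0 e1; rewrite t0.
Qed.

End Times.

(** * Comparisons with constants independent of the chain *)

Section Uniform.
Variable R : realType.
Implicit Types (C : finite_chain R) (alpha beta eta delta theta K : R).

(** The delay is [2 r] with [r] an integer between [K trel] and [K trel + 1]; the rounding is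
    absorbed by [trel >= 1]. *)
Lemma tmix_le_hit alpha eta : 0 < alpha -> alpha < 1 -> 0 < eta ->
  exists K, forall C, regular_chain C -> forall theta, 0 < theta ->
    (tmix C (theta + eta))%:R <= (hit C alpha theta)%:R + K * trel C.
Proof.
move=> a0 a1 eta0; have c0 : 0 < eta ^+ 2 * (1 - alpha) / 4.
  by rewrite divr_gt0// mulr_gt0 ?exprn_gt0// subr_gt0.
have [K K1 HK] := expRN_small c0; have K0 : 0 <= K by exact: le_trans K1.
exists (2 * (K + 1)) => C regC theta th0; have [lazyC revC irrC] := regC.
have trel1 := trel_ge1 lazyC revC irrC; have trel0 := lt_le_trans ltr01 trel1.
have [r r0 /andP[Kr rK]] := nat_ceil (mulr_ge0 K0 (ltW trel0)).
have [_ mn] := tmixP regC (addr_gt0 th0 eta0).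
have [h _] := hitP regC a0 th0.
have : (tmix C (theta + eta) <= hit C alpha theta + (r + r))%N.
  apply: mn; apply: (@le_trans _ _ (hit_prob C alpha (hit C alpha theta) + eta)).
    apply: dist_le_hit_prob => //.
      by apply: le_trans Kr; rewrite ler_peMl// ltW.
    by rewrite mulrC -ler_pdivlMr// HK// ler_pdivlMr.
  by rewrite lerD2r.
rewrite -(ler_nat R) !natrD => /le_trans; apply; rewrite lerD2l.
by lra.
Qed.

Lemma hit_change_level alpha beta delta : 0 < alpha -> 0 < beta -> beta < 1 ->
  0 < delta ->
  exists K, forall C, regular_chain C -> forall theta, 0 < theta ->
    (hit C alpha (theta + delta))%:R <= (hit C beta theta)%:R + K * trel C.
Proof.
move=> a0 b0 b1 d0; have c0 : 0 < delta ^+ 2 * (1 - beta).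
  by rewrite mulr_gt0 ?exprn_gt0// subr_gt0.
have [K K1 HK] := expRN_small c0.
have K0 : 0 <= K / alpha by rewrite divr_ge0 ?(le_trans _ K1)// ltW.
exists (K / alpha + 1) => C regC theta th0; have [lazyC revC irrC] := regC.
have trel1 := trel_ge1 lazyC revC irrC; have trel0 := lt_le_trans ltr01 trel1.
have [r r0 /andP[Kr rK]] := nat_ceil (mulr_ge0 K0 (ltW trel0)).
have [_ mn] := hitP regC a0 (addr_gt0 th0 d0).
have [h _] := hitP regC b0 th0.
have : (hit C alpha (theta + delta) <= hit C beta theta + r)%N.
  apply: mn; apply: (@le_trans _ _ (hit_prob C beta (hit C beta theta) + delta)).
    apply: hit_prob_change_level => //; first exact: ltW.
    by apply: HK; rewrite ler_pdivlMr// -ler_pdivrMl// mulrA [_^-1 * _]mulrC.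
  by rewrite lerD2r.
rewrite -(ler_nat R) !natrD => /le_trans; apply; rewrite lerD2l.
by lra.
Qed.

Lemma trel_le_hit K : exists eps, [/\ 0 < eps, eps < 1 / 4 &
  forall C, regular_chain C -> forall alpha, 0 < alpha -> alpha <= 1 / 2 ->
    K * trel C <= (hit C alpha eps)%:R].
Proof.
(* Below [exp (- 2 K)], the lower bound [exp (- 2 t / trel)] on survival forces [t > K trel]. *)
exists (Num.min (expR (- (2 * K)) / 2) (1 / 8)); split.
- by rewrite lt_min divr_gt0 ?expR_gt0//=; lra.
- by rewrite gt_min; apply/orP; right; lra.
set eps := Num.min _ _ => C regC alpha a0 a1; have [lazyC revC irrC] := regC.
have trel1 := trel_ge1 lazyC revC irrC; have trel0 := lt_le_trans ltr01 trel1.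
have eps0 : 0 < eps by rewrite lt_min divr_gt0 ?expR_gt0//=; lra.
have [h _] := hitP regC a0 eps0.
have := hit_prob_ge_expR lazyC revC irrC (hit C alpha eps) a1.
move=> /le_trans/(_ h) h'.
have : expR (- (2 * (hit C alpha eps)%:R / trel C)) < expR (- (2 * K)).
  apply: le_lt_trans h' _; rewrite gt_min; apply/orP; left.
  by rewrite ltr_pdivrMr// ltr_pMr ?expR_gt0// ltr1n.
rewrite ltr_expR ltrN2 ltr_pdivlMr// => h2.
by lra.
Qed.

Lemma trel_le_tmix K : exists eps, [/\ 0 < eps, eps < 1 / 4 &
  forall C, regular_chain C -> 1 / 2 <= lambda2 C -> K * trel C <= (tmix C eps)%:R].
Proof.
(* The divisor 4 also absorbs the factor 1/2 in the lower bound on the distance. *)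
exists (Num.min (expR (- (2 * K)) / 4) (1 / 8)); split.
- by rewrite lt_min divr_gt0 ?expR_gt0//=; lra.
- by rewrite gt_min; apply/orP; right; lra.
set eps := Num.min _ _ => C regC lh; have [lazyC revC irrC] := regC.
have trel1 := trel_ge1 lazyC revC irrC; have trel0 := lt_le_trans ltr01 trel1.
have eps0 : 0 < eps by rewrite lt_min divr_gt0 ?expR_gt0//=; lra.
have [h _] := tmixP regC eps0.
have := dist_ge_expR lazyC revC irrC (tmix C eps) lh.
move=> /le_trans/(_ h) h'.
have : expR (- (2 * (tmix C eps)%:R / trel C)) < expR (- (2 * K)).
  have : eps <= expR (- (2 * K)) / 4 by rewrite ge_min lexx.
  by have := expR_gt0 (- (2 * K)); lra.
rewrite ltr_expR ltrN2 ltr_pdivlMr// => h2.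
by lra.
Qed.

End Uniform.

(** * Cutoff *)

Section Asymptotics.
Local Open Scope classical_set_scope.
Variables (R : realType) (C : nat -> finite_chain R).
Hypothesis regC : forall n, regular_chain (C n).
Implicit Types (alpha beta eps c K : R) (u v : nat -> R).

Let trel_gt0 n : 0 < trel (C n).
Proof. by have [l r i] := regC n; exact: lt_le_trans (trel_ge1 l r i). Qed.

Let tmix_le n eps eps' : 0 < eps -> eps <= eps' ->
  (tmix (C n) eps')%:R <= (tmix (C n) eps)%:R :> R.
Proof. by move=> e0 ee; rewrite ler_nat; exact: tmix_anti. Qed.

Let hit_le n alpha beta eps eps' : 0 < alpha -> alpha <= beta ->
  0 < eps -> eps <= eps' ->
  (hit (C n) beta eps')%:R <= (hit (C n) alpha eps)%:R :> R.
Proof. by move=> *; rewrite ler_nat; exact: hit_anti. Qed.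

Lemma hit_cutoffP alpha : 0 < alpha -> hit_cutoff C alpha <->
  forall eps c, 0 < eps < 1 / 4 -> 0 < c -> \forall n \near \oo,
    (hit (C n) alpha eps)%:R - (hit (C n) alpha (1 - eps))%:R <=
      c * (hit (C n) alpha (1 / 4))%:R.
Proof.
move=> a0; split => [H eps c e01 c0|H eps e01].
  have /eqoP/(_ c c0) := H eps e01; apply: filterS => n.
  rewrite [X in _ * X]ger0_norm//; apply: le_trans; exact: ler_norm.
apply/eqoP => c c0; have := H eps c e01 c0; apply: filterS => n h.
rewrite [X in _ * X]ger0_norm// ger0_norm// subr_ge0.
by have /andP[e0 e1] := e01; apply: hit_le => //; lra.
Qed.

Lemma trel_negligibleP : trel_negligible C <->
  forall c, 0 < c -> \forall n \near \oo,
    trel (C n) <= c * (tmix (C n) (1 / 4))%:R.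
Proof.
split => [/eqoP H c c0|H].
  have := H c c0; apply: filterS => n.
  by rewrite [X in _ * X]ger0_norm// ger0_norm// ltW.
apply/eqoP => c c0; have := H c c0; apply: filterS => n h.
by rewrite [X in _ * X]ger0_norm// ger0_norm// ltW.
Qed.

Lemma trel_small_scale u : (forall n, 0 <= u n) ->
  (forall c, 0 < c -> \forall n \near \oo, trel (C n) <= c * u n) ->
  forall K c, 0 < c -> \forall n \near \oo, K * trel (C n) <= c * u n.
Proof.
move=> u0 H K c c0; have k0 : 0 < `|K| + 1 by rewrite ltr_wpDl.
have := H _ (divr_gt0 c0 k0); apply: filterS => n h.
apply: (@le_trans _ _ ((`|K| + 1) * trel (C n))).
  by rewrite ler_pM2r// (le_trans (ler_norm K))// lerDl.
apply: le_trans (ler_wpM2l (ltW k0) h) _.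
by rewrite mulrA [_ * (c / _)]mulrC divfK ?gt_eqF.
Qed.

Lemma cutoff_near : cutoff C -> forall eps c, 0 < eps < 1 -> 0 < c ->
  \forall n \near \oo,
    (tmix (C n) eps)%:R <= (1 + c) * (tmix (C n) (1 - eps))%:R.
Proof.
move=> H eps c e01 c0; pose d := Num.min c (1 / 2).
have d0 : 0 < d by rewrite lt_min c0 divr_gt0.
have dc : d <= c by rewrite ge_min lexx.
have dh : d <= 1 / 2 by rewrite ge_min lexx orbT.
have /cvgrPdist_le/(_ d d0) := H eps e01; apply: filterS => n.
(* A zero denominator makes the quotient 0, at distance 1 from the limit; [d <= 1/2] excludes
   this. *)
have [->|b0] := eqVneq (tmix (C n) (1 - eps)) 0%N.
  by rewrite invr0 mulr0 subr0 normr1; lra.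
have bpos : 0 < (tmix (C n) (1 - eps))%:R :> R by rewrite ltr0n lt0n.
rewrite ler_norml => /andP[h _].
by rewrite -ler_pdivrMr//; lra.
Qed.

(** Both times in the ratio lie between [tmix(1 - d)] and [tmix(d)] for a small enough [d], so small
    [eps] and one-sided bounds suffice. *)
Lemma near_cutoff :
  (forall eps c, 0 < eps -> eps < 1 / 4 -> 0 < c -> \forall n \near \oo,
    (0 < tmix (C n) (1 - eps))%N /\
    (tmix (C n) eps)%:R <= (1 + c) * (tmix (C n) (1 - eps))%:R) ->
  cutoff C.
Proof.
move=> H eps /andP[e0 e1]; apply/cvgrPdist_le => c c0.
pose d := Num.min (Num.min eps (1 - eps)) (1 / 8).
have d0 : 0 < d by rewrite !lt_min e0 subr_gt0 e1 divr_gt0.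
have de : d <= eps by rewrite !ge_min lexx.
have de' : d <= 1 - eps by rewrite !ge_min lexx !orbT.
have d8 : d <= 1 / 8 by rewrite !ge_min lexx !orbT.
have d4 : d < 1 / 4 by lra.
have := H d c d0 d4 c0; apply: filterS => n [].
have a1 : (tmix (C n) eps)%:R <= (tmix (C n) d)%:R :> R by exact: tmix_le.
have b1 : (tmix (C n) (1 - eps))%:R <= (tmix (C n) d)%:R :> R by exact: tmix_le.
have a2 : (tmix (C n) (1 - d))%:R <= (tmix (C n) eps)%:R :> R.
  by apply: tmix_le => //; lra.
have b2 : (tmix (C n) (1 - d))%:R <= (tmix (C n) (1 - eps))%:R :> R.
  by apply: tmix_le; lra.
move: a1 a2 b1 b2; rewrite -(ltr0n R).
set a := (tmix _ eps)%:R; set b := (tmix _ (1 - eps))%:R.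
set x := (tmix _ (1 - d))%:R; set y := (tmix _ d)%:R => a1 a2 b1 b2 x0 yx.
have bpos : 0 < b by lra.
have bc : x * c <= b * c by rewrite ler_pM2r.
rewrite ler_norml; apply/andP; split.
  have : a / b <= 1 + c by rewrite ler_pdivrMr//; lra.
  by lra.
have : 1 - c <= a / b.
  rewrite ler_pdivlMr//; have [c1|c1] := leP 1 c.
    by have : 0 <= (c - 1) * b by [rewrite mulr_ge0 ?subr_ge0// ltW]; lra.
  have : (1 - c) * b <= (1 - c) * ((1 + c) * x).
    by rewrite ler_pM2l ?subr_gt0//; lra.
  have : 0 <= c * c * x by rewrite !mulr_ge0 ?ltW.
  by lra.
by lra.
Qed.

(** If [tmix(1/4) < M], a ratio at most [1 + 1 / (M + 1)] and integrality give
    [tmix(eps) <= tmix(1 - eps)]; this forces [2^-M < 2 eps], against the choice of [eps]. *)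
Lemma cutoff_tmix_infty : cutoff C -> forall M : nat,
  \forall n \near \oo, (M <= tmix (C n) (1 / 4))%N.
Proof.
move=> H M; pose eps : R := (1 / 2) ^+ M / 8.
have p0 : 0 < (1 / 2 : R) ^+ M by rewrite exprn_gt0//; lra.
have p1 : (1 / 2 : R) ^+ M <= 1 by apply: exprn_ile1; lra.
have e0 : 0 < eps by rewrite divr_gt0.
have e1 : eps <= 1 / 8 by rewrite /eps; lra.
have e01 : 0 < eps < 1 by apply/andP; split; lra.
have c0 : 0 < (M.+1%:R : R)^-1 by rewrite invr_gt0.
have := cutoff_near H e01 c0; apply: filterS => n h.
rewrite leqNgt; apply/negP => small.
have tM : (tmix (C n) (1 - eps) < M)%N.
  by apply: leq_ltn_trans small; apply: tmix_anti => //; lra.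
have le : (tmix (C n) eps <= tmix (C n) (1 - eps))%N.
  rewrite -ltnS -(ltr_nat R) -natr1; apply: le_lt_trans h _.
  rewrite mulrDl mul1r ltrD2l mulrC ltr_pdivrMr// mul1r ltr_nat.
  exact: ltnW.
have eh : eps < 1 / 2 by lra.
have := tmix_eq_large (regC n) e0 eh le.
have : (1 / 2 : R) ^+ M <= (1 / 2) ^+ tmix (C n) eps.
  have h1 : 0 <= (1 / 2 : R) <= 1 by apply/andP; split; lra.
  by have /andP[h2 h3] := h1; apply: ler_wiXn2l => //; exact: ltnW (leq_ltn_trans le tM).
move=> /le_lt_trans/[apply]; rewrite /eps; move: ((1 / 2) ^+ M) p0 => p p0.
by lra.
Qed.

(** If [lambda2 >= 1/2], cutoff gives [(2 / c) trel <= tmix(eps) <= 2 tmix(1/4)]; otherwise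
    [trel <= 2], while the mixing time diverges. *)
Lemma cutoff_trel : cutoff C -> forall c, 0 < c -> \forall n \near \oo,
  trel (C n) <= c * (tmix (C n) (1 / 4))%:R.
Proof.
move=> H c c0; have [eps [e0 e1 He]] := trel_le_tmix (2 / c).
have e01 : 0 < eps < 1 by apply/andP; split; lra.
have c2 : 0 <= 2 / c by rewrite divr_ge0// ltW.
have [M _ /andP[HM _]] := nat_ceil c2.
have N1 := cutoff_near H e01 (ltr01 : 0 < 1 :> R).
have N2 := cutoff_tmix_infty H M.
apply: filterS2 N1 N2 => n h1 h2.
have m1 : (tmix (C n) (1 - eps))%:R <= (tmix (C n) (1 / 4))%:R :> R.
  by apply: tmix_le => //; lra.
have [lh|lh] := leP (1 / 2) (lambda2 (C n)).
  have := He _ (regC n) lh.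
  by rewrite mulrAC ler_pdivrMr// [_ * c]mulrC => h3; nra.
have : trel (C n) <= 2.
  have : (trel (C n))^-1 > 2^-1 by move: lh; rewrite lambda2E; lra.
  by rewrite ltf_pV2 ?posrE// => /ltW.
move=> /le_trans; apply; rewrite mulrC -ler_pdivrMr//.
by apply: le_trans HM _; rewrite ler_nat.
Qed.

(** Up to multiples of [trel], [hit_(1/2)(eps)] is at most [tmix(eps / 4)] (through the level
    [1 - eps / 4]) and [hit_(1/2)(1 - eps)] is at least [tmix(1 - eps / 2)]. *)
Lemma cutoff_hit_cutoff : cutoff C -> hit_cutoff C (1 / 2).
Proof.
move=> H; have h0 : 0 < 1 / 2 :> R by lra.
have h1 : 1 / 2 < 1 :> R by lra.
apply/hit_cutoffP => // eps c /andP[e0 e1] c0.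
have e2 : 0 < eps / 2 by lra.
have e4 : 0 < eps / 4 by lra.
have e41 : 0 < eps / 4 < 1 by apply/andP; split; lra.
have b0 : 0 < 1 - eps / 4 by lra.
have b1 : 1 - eps / 4 < 1 by lra.
have q8 : 0 < 1 / 8 :> R by lra.
have q4 : 0 < 1 / 4 :> R by lra.
have [K1 HK1] := hit_change_level h0 b0 b1 e2.
have [K2 HK2] := tmix_le_hit h0 h1 e2.
have [K3 HK3] := tmix_le_hit h0 h1 q8.
have small := trel_small_scale (fun n => ler0n _ _) (cutoff_trel H).
have c32 : 0 < c / 32 by lra.
have N1 := small K1 _ c32; have N2 := small K2 _ c32; have N3 := small K3 _ q4.
have N4 := cutoff_near H e41 c32.
have q41 : 0 < (1 / 4 : R) < 1 by apply/andP; split; lra.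
have N5 := cutoff_near H q41 ltr01.
apply: filterS3 (filterI N1 N2) N3 (filterI N4 N5) => n [n1 n2] n3 [n4 n5].
have i1 := HK1 _ (regC n) _ e2; have e1' : 0 < 1 - eps by lra.
have i2 := HK2 _ (regC n) _ e1'; have i3 := HK3 _ (regC n) _ q4.
have i4 : (hit (C n) (1 - eps / 4) (eps / 4 + eps / 4))%:R <= (tmix (C n) (eps / 4))%:R :> R.
  by rewrite ler_nat; apply: hit_le_tmix => //; lra.
have E1 : eps / 2 + eps / 2 = eps by field.
have E2 : eps / 4 + eps / 4 = eps / 2 by field.
have E3 : 1 - eps + eps / 2 = 1 - eps / 2 by field.
rewrite E1 in i1; rewrite E2 in i4; rewrite E3 in i2.
have m1 : (tmix (C n) (1 - eps / 4))%:R <= (tmix (C n) (1 - eps / 2))%:R :> R.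
  by apply: tmix_le; lra.
have m2 : (tmix (C n) (1 - eps / 4))%:R <= (tmix (C n) (1 / 4))%:R :> R.
  by apply: tmix_le; lra.
have m3 : (tmix (C n) (1 - 1 / 4))%:R <= (tmix (C n) (1 / 4 + 1 / 8))%:R :> R.
  by apply: tmix_le; lra.
set m := (tmix (C n) (1 / 4))%:R in n1 n2 n3 n5 m2 *.
set h := (hit (C n) (1 / 2) (1 / 4))%:R in i3 *.
(* [m <= 2 tmix(3/4) <= 2 tmix(3/8) <= 2 (h + m / 4)]: errors relative to [m] become errors relative
   to [h]. *)
have mh : m <= 4 * h by lra.
have : c * m <= c * (4 * h) by rewrite ler_pM2l.
have : c * (tmix (C n) (1 - eps / 4))%:R <= c * m by rewrite ler_pM2l.
have : 0 <= c * h by rewrite mulr_ge0// ltW.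
by lra.
Qed.

(** * Consequences of a hit-cutoff at a level at most 1/2 *)

Section FromHit.
Variable alpha : R.
Hypotheses (a0 : 0 < alpha) (a1 : alpha <= 1 / 2) (hc : hit_cutoff C alpha).

(** By the choice of [eps] and the cutoff, [(2 / c) trel <= hit(eps) <= 2 hit(1/4)]. *)
Lemma hit_cutoff_trel c : 0 < c -> \forall n \near \oo,
  trel (C n) <= c * (hit (C n) alpha (1 / 4))%:R.
Proof.
move=> c0; have [eps [e0 e1 He]] := trel_le_hit (2 / c).
have e01 : 0 < eps < 1 / 4 by rewrite e0.
have N1 := (hit_cutoffP a0).1 hc eps 1 e01 ltr01.
apply: filterS N1 => n n1; have := He _ (regC n) _ a0 a1.
have : (hit (C n) alpha (1 - eps))%:R <= (hit (C n) alpha (1 / 4))%:R :> R.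
  by apply: hit_le => //; lra.
rewrite mulrAC ler_pdivrMr// [_ * c]mulrC => h1 h2.
by nra.
Qed.

(** With [h = hit_alpha(1/4)]: [h <= hit_alpha(7/8) + h / 4], and changing the level to 3/4 costs at
    most another [h / 4]. The right-hand side is then comparable with [tmix(1/2)]. *)
Lemma hit_cutoff_hit34 : \forall n \near \oo,
  (hit (C n) alpha (1 / 4))%:R <= 2 * (hit (C n) (3 / 4) (3 / 4))%:R :> R.
Proof.
have q4 : 0 < 1 / 4 :> R by lra.
have q8 : 0 < 1 / 8 :> R by lra.
have t0 : 0 < 3 / 4 :> R by lra.
have t1 : 3 / 4 < 1 :> R by lra.
have e01 : 0 < (1 / 8 : R) < 1 / 4 by apply/andP; split; lra.
have [K HK] := hit_change_level a0 t0 t1 q8.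
have N1 := (hit_cutoffP a0).1 hc _ _ e01 q4.
have N2 := trel_small_scale (fun n => ler0n _ _) hit_cutoff_trel K q4.
apply: filterS2 N1 N2 => n n1 n2; have i1 := HK _ (regC n) _ t0.
have E : 3 / 4 + 1 / 8 = 1 - 1 / 8 :> R by field.
rewrite E in i1.
have : (hit (C n) alpha (1 / 4))%:R <= (hit (C n) alpha (1 / 8))%:R :> R.
  by apply: hit_le => //; lra.
by lra.
Qed.

Lemma hit_cutoff_trel_negligible : trel_negligible C.
Proof.
apply/trel_negligibleP => c c0.
have c2 : 0 < c / 2 by lra.
apply: filterS2 (hit_cutoff_trel c2) hit_cutoff_hit34 => n n1 n2.
have q4 : 0 < 1 / 4 :> R by lra.
have q41 : 1 / 4 < 1 :> R by lra.
have q2 : 0 < 1 / 2 :> R by lra.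
have := hit_le_tmix (regC n) q4 q41 q2.
have -> : 1 - 1 / 4 = 3 / 4 :> R by field.
have -> : 1 / 2 + 1 / 4 = 3 / 4 :> R by field.
rewrite -(ler_nat R) => i1.
have i2 : (tmix (C n) (1 / 2))%:R <= (tmix (C n) (1 / 4))%:R :> R.
  by apply: tmix_le => //; lra.
by nra.
Qed.

(** Raising the level lowers [hit(eps)], and it lowers [hit(1 - eps)] by only O(trel) at the price
    of [eps / 2], so the window at level 3/4 is at most that at [alpha] plus a negligible term. *)
Lemma hit_cutoff_34 : hit_cutoff C (3 / 4).
Proof.
have t0 : 0 < 3 / 4 :> R by lra.
have t1 : 3 / 4 < 1 :> R by lra.
apply/hit_cutoffP => // eps c /andP[e0 e1] c0.
have e2 : 0 < eps / 2 by lra.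
have e21 : 0 < eps / 2 < 1 / 4 by apply/andP; split; lra.
have c4 : 0 < c / 4 by lra.
have [K HK] := hit_change_level a0 t0 t1 e2.
have N1 := (hit_cutoffP a0).1 hc _ _ e21 c4.
have N2 := trel_small_scale (fun n => ler0n _ _) hit_cutoff_trel K c4.
apply: filterS3 N1 N2 hit_cutoff_hit34 => n n1 n2 n3.
have e1' : 0 < 1 - eps by lra.
have i1 := HK _ (regC n) _ e1'.
have E : 1 - eps + eps / 2 = 1 - eps / 2 by field.
rewrite E in i1.
have i2 : (hit (C n) (3 / 4) eps)%:R <= (hit (C n) alpha (eps / 2))%:R :> R.
  have a34 : alpha <= 3 / 4 by apply: le_trans a1 _; lra.
  by apply: hit_le => //; lra.
have i3 : (hit (C n) (3 / 4) (3 / 4))%:R <= (hit (C n) (3 / 4) (1 / 4))%:R :> R.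
  by apply: hit_le => //; lra.
have : c * (hit (C n) alpha (1 / 4))%:R <= c * (2 * (hit (C n) (3 / 4) (1 / 4))%:R).
  by rewrite ler_pM2l//; lra.
by lra.
Qed.

End FromHit.

(** Up to multiples of [trel], [tmix(eps) <= hit_beta(eps / 2)] and [hit_beta(1 - eps / 4) <= hit_(1
    - eps/2)(1 - eps/2) <= tmix(1 - eps)]; the hit-cutoff joins the two. *)
Lemma hit_cutoff_cutoff beta : 0 < beta -> beta < 1 -> hit_cutoff C beta ->
  trel_negligible C -> cutoff C.
Proof.
move=> b0 b1 hc /trel_negligibleP tn; apply: near_cutoff => eps c e0 e1 c0.
pose d := Num.min c 1 / 32.
have d0 : 0 < d by rewrite divr_gt0// lt_min c0 ltr01.
have dc : d <= c / 32 by rewrite ler_pM2r ?invr_gt0// ge_min lexx.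
have d1 : d <= 1 / 32 by rewrite ler_pM2r ?invr_gt0// ge_min lexx orbT.
have e2 : 0 < eps / 2 by lra.
have e4 : 0 < eps / 4 by lra.
have e41 : 0 < eps / 4 < 1 / 4 by apply/andP; split; lra.
have g0 : 0 < 1 - eps / 2 by lra.
have g1 : 1 - eps / 2 < 1 by lra.
have q4 : 0 < 1 / 4 :> R by lra.
have q41 : 1 / 4 < 1 :> R by lra.
have q2 : 0 < 1 / 2 :> R by lra.
have q8 : 0 < 1 / 8 :> R by lra.
have q81 : 0 < (1 / 8 : R) < 1 / 4 by apply/andP; split; lra.
have t0 : 0 < 3 / 4 :> R by lra.
have t1 : 3 / 4 < 1 :> R by lra.
have [K1 HK1] := tmix_le_hit b0 b1 e2.
have [K2 HK2] := hit_change_level b0 g0 g1 e4.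
have [K3 HK3] := hit_change_level b0 t0 t1 q8.
have small := trel_small_scale (fun n => ler0n _ _) tn.
have N1 := small K1 _ d0; have N2 := small K2 _ d0; have N3 := small K3 _ ltr01.
have N4 := (hit_cutoffP b0).1 hc _ _ e41 d0.
have N5 := (hit_cutoffP b0).1 hc _ _ q81 q4.
apply: filterS3 (filterI N1 N2) N3 (filterI N4 N5) => n [n1 n2] n3 [n4 n5].
have e1' : 0 < 1 - eps by lra.
have i1 := HK1 _ (regC n) _ e2; have i2 := HK2 _ (regC n) _ g0.
have i3 := HK3 _ (regC n) _ t0.
have i4 : (hit (C n) (1 - eps / 2) (1 - eps + eps / 2))%:R <= (tmix (C n) (1 - eps))%:R :> R.
  by rewrite ler_nat; apply: hit_le_tmix => //; lra.
have i5 : (hit (C n) (3 / 4) (3 / 4))%:R <= (tmix (C n) (1 / 2))%:R :> R.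
  have := hit_le_tmix (regC n) q4 q41 q2.
  have -> : 1 - 1 / 4 = 3 / 4 :> R by field.
  have -> : 1 / 2 + 1 / 4 = 3 / 4 :> R by field.
  by rewrite ler_nat.
have i6 : (tmix (C n) (1 / 2))%:R <= (tmix (C n) (1 / 4))%:R :> R.
  by apply: tmix_le => //; lra.
have E1 : eps / 2 + eps / 2 = eps by field.
have E2 : 1 - eps / 2 + eps / 4 = 1 - eps / 4 by field.
have E3 : 1 - eps + eps / 2 = 1 - eps / 2 by field.
have E4 : 3 / 4 + 1 / 8 = 1 - 1 / 8 :> R by field.
rewrite E1 in i1; rewrite E2 in i2; rewrite E3 in i4; rewrite E4 in i3.
have i7 : (hit (C n) beta (eps / 2))%:R <= (hit (C n) beta (eps / 4))%:R :> R.
  by apply: hit_le => //; lra.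
have i8 : (hit (C n) beta (1 / 4))%:R <= (hit (C n) beta (1 / 8))%:R :> R.
  by apply: hit_le => //; lra.
have i9 : (tmix (C n) (1 / 4))%:R <= (tmix (C n) eps)%:R :> R.
  by apply: tmix_le => //; lra.
have mpos : 0 < (tmix (C n) (1 / 4))%:R :> R.
  by rewrite ltr0n; apply: tmix_gt0 => //; lra.
rewrite -(ltr0n R).
set m := (tmix (C n) (1 / 4))%:R in n1 n2 n3 i6 i9 mpos.
set h := (hit (C n) beta (1 / 4))%:R in n4 n5 i8.
set a := (tmix (C n) eps)%:R in i1 i9 *.
set b := (tmix (C n) (1 - eps))%:R in i4 *.
(* [h <= hit_beta(7/8) + h / 4 <= m + m + h / 4]. *)
have h3 : h <= 3 * m by lra.
have dh : d * h <= d * (3 * m) by rewrite ler_pM2l.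
have ab : a <= b + 5 * (d * m) by lra.
have dm : d * m <= 1 / 32 * m by rewrite ler_pM2r.
(* From [m <= a <= b + 5 m / 32]: the error [5 d m] is thus small relative to [b] itself, which is
   positive. *)
have mb : m <= 2 * b by lra.
have bpos : 0 < b by lra.
split => //; have : d * m <= c / 32 * m by rewrite ler_pM2r.
have : c * m <= c * (2 * b) by rewrite ler_pM2l.
have : 0 < c * b by rewrite mulr_gt0.
by lra.
Qed.

End Asymptotics.

Theorem theorem3 (R : realType) (C : nat -> finite_chain R)
  (lazyC : forall n, is_lazy (C n))
  (reversibleC : forall n, is_reversible (C n))
  (irreducibleC : forall n, is_irreducible (C n)) :
  [<-> cutoff C;
       exists2 alpha : R, 0 < alpha <= 1 / 2 & hit_cutoff C alpha;
       (exists2 alpha : R, 1 / 2 < alpha < 1 & hit_cutoff C alpha)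
         /\ trel_negligible C].
Proof.
have regC n : regular_chain (C n) by [].
tfae => [cut|[alpha /andP[a0 a1] hc]|[[beta /andP[b0 b1] hc] tn]].
- exists (1 / 2); last exact: cutoff_hit_cutoff.
  by apply/andP; split; lra.
- split; last exact: hit_cutoff_trel_negligible hc.
  exists (3 / 4); last exact: hit_cutoff_34 hc.
  by apply/andP; split; lra.
- by apply: hit_cutoff_cutoff hc tn => //; lra.
Qed.
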